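(* Let $\Bbbk$, $Q$, $S_Q$, $\lambda$, $\Bbbk[S_Q]$, $\Theta$ and the elements $R_{J,A}$ be as in the context (in particular all proper faces of $Q$ are acyclic over $\Bbbk$). Let $\langle[X_I]\rangle$ be the free $\Bbbk$-module generated by the elements $[X_I]$, $I\in S_Q$, and let $\varphi\colon\langle[X_I]\rangle\to\Bbbk[S_Q]$ be the degree reversing linear map which sends the generator $[X_I]$ to $v_I$. Then $\varphi$ descends to an isomorphism of $\Bbbk$-modules $$\tilde\varphi\colon\langle[X_I]\rangle/\langle R_{J,A}\rangle\to\Bbbk[S_Q]/\Theta,$$ where $\langle R_{J,A}\rangle$ is the submodule spanned by all $R_{J,A}$ with $J\in S_Q$, $A\subset[n]$, $|J|=n-q-1$, $|A|=q$, $0\leqslant q\leqslant n-1$.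
   Context: Setting. $\Bbbk$ is a ground ring. $T^n=(S^1)^n$, $[n]=\{1,\dots,n\}$. $Q$ is a compact connected orientable smooth $n$-dimensional manifold with corners in which every codimension $k$ face lies in exactly $k$ facets (faces are connected; $Q$ is the face of codimension $0$), and every proper face of $Q$ is acyclic over $\Bbbk$. $S_Q$ is the poset of faces ordered by reversed inclusion, a simplicial poset; the face corresponding to $I\in S_Q$ is $F_I$; the minimal element $\hat0$ corresponds to $Q$; vertices $i$ of $S_Q$ correspond to facets $F_i$; $|I|$ is the number of vertices of $I$, $\dim F_I=n-|I|$. A characteristic function $\lambda$ assigns to each facet $F_i$ a one-dimensional toric subgroup $T_i\subset T^n$ such that whenever $F_{i_1}\cap\dots\cap F_{i_k}\neq\emptyset$ the map $T_{i_1}\times\dots\times T_{i_k}\to T^n$ is injective and splits. Fix a generator $\omega_i$ of $H_1(T_i;\mathbb{Z})\subset H_1(T^n;\mathbb{Z})$ with coordinates $(\lambda_{i,1},\dots,\lambda_{i,n})$ in the standard basis of $H_1(T^n;\mathbb{Z})=\mathbb{Z}^n$. Face ring: $\Bbbk[S_Q]$ is the quotient of $\Bbbk[v_I\mid I\in S_Q]$, $\deg v_I=2|I|$, by $v_{\hat0}=1$ and $v_{I_1}v_{I_2}=v_{I_1\cap I_2}\sum_{J\in I_1\vee I_2}v_J$, where $I_1\vee I_2$ is the set of least upper bounds (minimal common upper bounds), $I_1\cap I_2$ is the intersection of simplices (well defined if $I_1\vee I_2\ne\emptyset$), and the right side is $0$ if $I_1\vee I_2=\emptyset$. $\Theta=(\theta_1,\dots,\theta_n)$,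 $\theta_j=\sum_i\lambda_{i,j}v_i$ (sum over vertices). The symbol $[X_I]$ has degree $2(n-|I|)$ (it stands for the class of a face submanifold of dimension $2(n-|I|)$ in the $2n$-manifold $X=(Q\times T^n)/\!\sim$). Orientations: for each $I\neq\hat0$ fix an orientation, i.e. a rule declaring each total ordering of the vertices of $I$ positive or negative, invariant under even and changing under odd permutations (the empty ordering for $\hat0$ is positive). If $J<I$, $|I|=|J|+1$, $i$ is the vertex of $I$ not in $J$, and $(j_1,\dots,j_s)$ is a positive ordering for $J$, then $[I\!:\!J]=+1$ if $(i,j_1,\dots,j_s)$ is positive for $I$ and $-1$ otherwise. Constants: for $|I|=n-q>0$ with positively ordered vertices $i_1,\dots,i_{n-q}$ and $A\subset[n]$, $|A|=q$, $C_{I,A}=\mathrm{sgn}_A\det(\lambda_{i,j})_{i\in\{i_1,\dots,i_{n-q}\},\,j\in[n]\setminus A}$ (rows in the order $i_1,\dots,i_{n-q}$, columns increasing), $\mathrm{sgn}_A=(-1)^{\sum_{r=1}^{n-q}r+\sum_{s\in[n]\setminus A}s}$. For $|J|=n-q-1$, $|A|=q$: $R_{J,A}=\sum_{I>J,\ |I|=|J|+1}[I\!:\!J]\,C_{I,A}\,[X_I]\in\langle[X_I]\rangle$. *)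

(* Defs.v *)
From HB Require Import structures.
From mathcomp Require Import all_boot all_order all_algebra fingroup perm.
From mathcomp Require Import ring_quotient generic_quotient.
From mathcomp Require Import finmap.
From mathcomp Require Import all_classical all_reals all_analysis.
From mathcomp Require Import complex.
(* Only the canonical instances are imported: the notations of these
   files are incompatible with those of mathcomp-analysis. *)
From mathcomp Require mpoly monalg.
Export (canonicals) mpoly monalg.

Set Implicit Arguments.
Unset Strict Implicit.
Unset Printing Implicit Defensive.

Import Order.TTheory GRing.Theory Num.Theory.
Import numFieldNormedType.Exports.

Local Open Scope classical_set_scope.
Local Open Scope ring_scope.
Local Open Scope quotient_scope.

Section Smooth.
Variables (R : realType) (n : nat).
Local Notation E := 'rV[R]_n.

Definition partial_derivative (f : E -> R) (j : 'I_n) : E -> R :=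
  fun x => derive f x (delta_mx ord0 j : E).

Fixpoint class_C (r : nat) (U : set E) (f : E -> R) : Prop :=
  (forall x, U x -> {for x, continuous f}) /\
  (if r is r'.+1 then
     forall j : 'I_n,
       (forall x, U x -> derivable f x (delta_mx ord0 j : E)) /\
       class_C r' U (partial_derivative f j)
   else True).

Definition smooth_on (U : set E) (g : E -> E) : Prop :=
  forall (r : nat) (j : 'I_n), class_C r U (fun x => g x ord0 j).

Definition jacobian_matrix (g : E -> E) (x : E) : 'M[R]_n :=
  \matrix_(i, j) partial_derivative (fun y => g y ord0 j) i x.

Definition orthant : set E := [set x | forall j, 0 <= x ord0 j].

End Smooth.

Arguments orthant : clear implicits.

Section ManifoldWithCorners.
Variables (R : realType) (n : nat) (Q : topologicalType).

Record chart := Chart { dom : set Q; coord :> Q -> 'rV[R]_n }.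

Definition is_chart (c : chart) : Prop :=
  [/\ open (dom c),
      forall p q, dom c p -> dom c q -> c p = c q -> p = q,
      forall p, dom c p -> {for p, continuous (coord c)}
    & forall W : set Q, open W -> W `<=` dom c ->
        exists2 O : set 'rV[R]_n, open O & c @` W = O `&` orthant R n].

(* On a subset of the orthant, smoothness means local extendability to a
   smooth map on an open subset of R^n; [g] is such an extension, near the
   point [c1 p], of the change of coordinates from [c1] to [c2]. *)
Definition transition_at (c1 c2 : chart) (p : Q)
    (O : set 'rV[R]_n) (g : 'rV[R]_n -> 'rV[R]_n) : Prop :=
  [/\ open O, O (c1 p), smooth_on O g
    & forall q, dom c1 q -> dom c2 q -> O (c1 q) -> c2 q = g (c1 q)].

(* Second countability is not listed: it is automatic for compact [Q]. *)
Definition manifold_with_corners (A : set chart) : Prop :=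
  [/\ hausdorff_space Q,
      forall c, A c -> is_chart c,
      forall p, exists2 c, A c & dom c p
    & forall c1 c2 p, A c1 -> A c2 -> dom c1 p -> dom c2 p ->
        exists O g, transition_at c1 c2 p O g].

(* Positivity of all Jacobians for some choice of a locally constant sign on
   every chart.  The signs are needed: with values in [0, +oo), a segment has
   no atlas all of whose changes of coordinates preserve the orientation. *)
Definition orientable (A : set chart) : Prop :=
  exists e : chart -> Q -> bool,
    (forall c p, A c -> dom c p -> \forall q \near p, e c q = e c p) /\
    (forall c1 c2 p O g, A c1 -> A c2 -> dom c1 p -> dom c2 p ->
       transition_at c1 c2 p O g ->
       0 < (-1) ^+ (e c1 p (+) e c2 p)%B * \det (jacobian_matrix g (c1 p))).

Definition stratum (A : set chart) (k : nat) : set Q :=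
  [set p | exists c, [/\ A c, dom c p & #|[set j | c p ord0 j == 0]%SET| = k]].

Definition is_face (A : set chart) (k : nat) (G : set Q) : Prop :=
  exists2 p, stratum A k p & G = closure (connected_component (stratum A k) p).

Definition faces_in_expected_facets (A : set chart) : Prop :=
  forall k G, is_face A k G ->
    ([set H | is_face A 1 H /\ G `<=` H] #= `I_k)%card.

(* [F] labels the faces by a finite poset, inclusion of faces being reversed;
   it is then automatically injective. *)
Definition is_face_poset (A : set chart) d (S : finBPOrderType d)
    (F : S -> set Q) : Prop :=
  [/\ forall I, exists k, is_face A k (F I),
      forall k G, is_face A k G -> exists I, F I = G
    & forall I J : S, (I <= J)%O <-> F J `<=` F I].

End ManifoldWithCorners.

Section SingularHomology.
Variables (k : comNzRingType) (R : realType) (Q : topologicalType).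

Definition std_simplex (m : nat) : set 'rV[R]_m.+1 :=
  [set x | (forall j, 0 <= x ord0 j) /\ \sum_j x ord0 j = 1].
Arguments std_simplex : clear implicits.

Definition insert0 (m : nat) (i : 'I_m.+2) (x : 'rV[R]_m.+1) : 'rV[R]_m.+2 :=
  \row_j (if unlift i j is Some j' then x ord0 j' else 0).

Lemma insert0_std m (i : 'I_m.+2) x :
  std_simplex m x -> std_simplex m.+1 (insert0 i x).
Proof.
move=> [x0 x1]; split=> [j|].
  by rewrite mxE; case: unliftP.
rewrite (bigD1_ord i) //= mxE unlift_none add0r -[RHS]x1.
by apply: eq_bigr => j _; rewrite mxE liftK.
Qed.

Definition coface (m : nat) (i : 'I_m.+2) (x : std_simplex m) :
    std_simplex m.+1 :=
  exist _ (insert0 i (val x)) (mem_set (insert0_std i (set_mem (valP x)))).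

Definition chain (m : nat) := monalg.malg (std_simplex m -> Q) k.

(* The chains spanned by the singular simplices of the subspace [G]. *)
Definition chain_in (G : set Q) (m : nat) (c : chain m) : Prop :=
  forall s, s \in monalg.msupp c -> continuous s /\ (forall x, G (s x)).

Definition boundary (m : nat) (c : chain m.+1) : chain m :=
  \sum_(s <- monalg.msupp c) \sum_(i < m.+2)
    monalg.mkmalgU (s \o coface i) ((-1) ^+ i * monalg.mcoeff s c).

Definition augmentation (c : chain 0) : k :=
  \sum_(s <- monalg.msupp c) monalg.mcoeff s c.

(* Vanishing of reduced singular homology, in degrees -1, 0 and m + 1. *)
Definition acyclic (G : set Q) : Prop :=
  [/\ G !=set0,
      forall c : chain 0, chain_in G c -> augmentation c = 0 ->
        exists2 b : chain 1, chain_in G b & boundary b = c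
    & forall m (c : chain m.+1), chain_in G c -> boundary c = 0 ->
        exists2 b : chain m.+2, chain_in G b & boundary b = c].

End SingularHomology.

Definition acyclic_proper_faces (k : comNzRingType) (R : realType) (n : nat)
    (Q : topologicalType) (A : set (chart R n Q)) : Prop :=
  forall c G, (0 < c)%N -> is_face A c G -> acyclic k R G.

Section SimplicialPoset.
Variables (d : Order.disp_t) (S : finBPOrderType d).
Local Open Scope order_scope.
Implicit Types I J L M : S.

Definition simplicial_poset : Prop :=
  forall I, exists (m : nat) (f : S -> {set 'I_m}),
    (forall x y, x <= I -> y <= I -> (x <= y) = (f x \subset f y)) /\
    (forall B, exists2 x, x <= I & f x = B).

Definition vertex (i : S) : bool :=
  (i != \bot) && [forall x : S, (x < i) ==> (x == \bot)].

Definition vertices I : {set S} := [set i | vertex i & i <= I]%SET.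

Definition card_simplex I : nat := #|vertices I|.

Definition upper_bound I J L : bool := (I <= L) && (J <= L).

Definition joins I J : {set S} :=
  [set L | upper_bound I J L &
     [forall L' : S, (upper_bound I J L' && (L' <= L)) ==> (L' == L)]]%SET.

Definition is_meet I J M : Prop :=
  [/\ M <= I, M <= J & forall L, L <= I -> L <= J -> L <= M].

Definition is_ordering I (s : seq S) : Prop := uniq s /\ s =i vertices I.

Definition reorder (s : seq S) (p : 'S_(size s)) : seq S :=
  [seq tnth (in_tuple s) (p i) | i : 'I_(size s)].

(* [o I s = true] when the ordering [s] of the vertices of [I] is positive. *)
Definition is_orientation (o : S -> seq S -> bool) : Prop :=
  o \bot [::] /\
  forall I (s : seq S) (p : 'S_(size s)),
    is_ordering I s -> o I (reorder p) = o I s (+) odd_perm p.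

End SimplicialPoset.

(* Through [numFieldType], the complex numbers get their usual topology. *)
Definition complexes (R : realType) : numFieldType := R[i].

Section Torus.
Variables (R : realType) (n : nat).
Local Notation C := (complexes R).

Definition circle : set C := [set z | `|z| = 1].

Definition torus : set 'rV[C]_n := [set t | forall j, circle (t ord0 j)].

Definition torus_mul (s t : 'rV[C]_n) : 'rV[C]_n :=
  \row_j (s ord0 j * t ord0 j).

Definition loop (w : 'I_n -> int) (z : C) : 'rV[C]_n := \row_j (z ^ w j).

(* [loop w] is an isomorphism from the circle onto [T], so that [T] is a
   one-dimensional toric subgroup, [loop w] represents a generator of
   H_1(T; Z), and [w] are the coordinates of this generator in
   H_1(T^n; Z) = Z^n.  Both generators of a given [T] are of this form. *)
Definition toric_generator (T : set 'rV[C]_n) (w : 'I_n -> int) : Prop :=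
  (forall z z', circle z -> circle z' -> loop w z = loop w z' -> z = z') /\
  T = loop w @` circle.

Section Family.
Variables (I : finType) (T : I -> set 'rV[C]_n) (A : {set I}).

Definition in_product (t : I -> 'rV[C]_n) : Prop :=
  forall i, i \in A -> T i (t i).

Definition product_map (t : I -> 'rV[C]_n) : 'rV[C]_n :=
  \row_j \prod_(i in A) t i ord0 j.

Definition product_injective : Prop :=
  forall s t, in_product s -> in_product t ->
    product_map s = product_map t -> forall i, i \in A -> s i = t i.

(* The components [r i] of a continuous homomorphism from T^n to the product
   of the T_i that is a left inverse of the product map. *)
Definition product_splits : Prop :=
  exists r : I -> 'rV[C]_n -> 'rV[C]_n,
    (forall i, i \in A ->
       [/\ {within torus, continuous (r i)},
           forall x, torus x -> T i (r i x)
         & forall x y, torus x -> torus y ->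
             r i (torus_mul x y) = torus_mul (r i x) (r i y)]) /\
    (forall t, in_product t ->
       forall i, i \in A -> r i (product_map t) = t i).

End Family.

(* The vertices of the face poset are the facets, and [T] is only relevant on
   them. *)
Definition characteristic_function d (S : finBPOrderType d)
    (Q : topologicalType) (F : S -> set Q) (T : S -> set 'rV[C]_n) : Prop :=
  (forall i, vertex i -> exists w, toric_generator (T i) w) /\
  (forall A : {set S}, (forall i, i \in A -> vertex i) ->
     \bigcap_(i in [set` A]) F i !=set0 ->
     product_injective T A /\ product_splits T A).

End Torus.

Section SubmoduleSpan.
Variables (k : nzRingType) (V : lmodType k) (G : set V).

Definition submodule_span : {pred V} := fun x : V =>
  `[< exists s : seq (k * V),
        (forall p, p \in s -> G p.2) /\ x = \sum_(p <- s) p.1 *: p.2 >].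

Lemma submodule_span_closed : submod_closed submodule_span.
Proof.
split; first by apply/asboolP; exists [::]; rewrite big_nil.
move=> a x y /asboolP[s [sG ->]] /asboolP[t [tG ->]]; apply/asboolP.
exists ([seq (a * p.1, p.2) | p <- s] ++ t); split.
  by move=> p; rewrite mem_cat => /orP[/mapP[q /sG qG ->]|/tG].
rewrite big_cat big_map scaler_sumr; congr (_ + _).
by apply: eq_bigr => p _; rewrite scalerA.
Qed.

HB.instance Definition _ := GRing.isSubmodClosed.Build k V submodule_span
  (GRing.submod_closed_semi submodule_span_closed).

End SubmoduleSpan.

Section IdealSpan.
Variables (k : nzRingType) (B : comAlgType k) (G : set B).

Definition ideal_span : {pred B} := fun x : B =>
  `[< exists s : seq (B * B),
        (forall p, p \in s -> G p.2) /\ x = \sum_(p <- s) p.1 * p.2 >].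

Lemma ideal_span0 : 0 \in ideal_span.
Proof. by apply/asboolP; exists [::]; rewrite big_nil. Qed.

Lemma ideal_spanP (a : B) :
  {in ideal_span &, forall x y, a * x + y \in ideal_span}.
Proof.
move=> x y /asboolP[s [sG ->]] /asboolP[t [tG ->]]; apply/asboolP.
exists ([seq (a * p.1, p.2) | p <- s] ++ t); split.
  by move=> p; rewrite mem_cat => /orP[/mapP[q /sG qG ->]|/tG].
rewrite big_cat big_map mulr_sumr; congr (_ + _).
by apply: eq_bigr => p _; rewrite mulrA.
Qed.

Lemma ideal_span_submod_closed : submod_closed ideal_span.
Proof.
split; first exact: ideal_span0.
by move=> a x y xI yI; rewrite -mulr_algl; apply: ideal_spanP.
Qed.

HB.instance Definition _ := GRing.isSubmodClosed.Build k B ideal_span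
  (GRing.submod_closed_semi ideal_span_submod_closed).

End IdealSpan.

Section QuotientModule.
Variables (k : nzRingType) (V : lmodType k) (W : zmodClosed V).
Hypothesis W_scale : forall a x, x \in W -> a *: x \in W.
Local Notation Quo := {ideal_quot W}.

Definition quot_scale (a : k) (x : Quo) : Quo := \pi_Quo (a *: repr x).

Lemma pi_scale a (x : V) : \pi_Quo (a *: x) = quot_scale a (\pi_Quo x).
Proof.
apply/eqP; rewrite /quot_scale -Quotient.idealrBE -scalerBr W_scale //.
by rewrite Quotient.idealrBE reprK.
Qed.

Lemma quot_scaleA a b x : quot_scale a (quot_scale b x) = quot_scale (a * b) x.
Proof.
elim/quotP: x => x _; rewrite -(pi_scale b x) -(pi_scale (a * b) x).
by rewrite -(pi_scale a (b *: x)) scalerA.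
Qed.

Lemma quot_scale1 : left_id 1 quot_scale.
Proof. by elim/quotP => x _; rewrite -(pi_scale 1 x) scale1r. Qed.

Lemma quot_scaleDr : right_distributive quot_scale +%R.
Proof.
move=> a; elim/quotP => x _; elim/quotP => y _.
rewrite -(raddfD (\pi_Quo)) -(pi_scale a (x + y)).
by rewrite -(pi_scale a x) -(pi_scale a y) -(raddfD (\pi_Quo)) scalerDr.
Qed.

Lemma quot_scaleDl x : {morph quot_scale^~ x : a b / a + b}.
Proof.
elim/quotP: x => x _ a b /=.
rewrite -(pi_scale (a + b) x) -(pi_scale a x) -(pi_scale b x).
by rewrite -(raddfD (\pi_Quo)) scalerDl.
Qed.

End QuotientModule.

Section QuotientBySubmodule.
Variables (k : nzRingType) (V : lmodType k) (G : set V).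

Definition module_quotient := {ideal_quot (submodule_span G)}.

Let span_scale (a : k) x : x \in submodule_span G -> a *: x \in submodule_span G.
Proof. exact: rpredZ. Qed.

HB.instance Definition _ := GRing.Zmodule.on module_quotient.
HB.instance Definition _ := GRing.Zmodule_isLmodule.Build k module_quotient
  (quot_scaleA span_scale) (quot_scale1 span_scale)
  (quot_scaleDr span_scale) (quot_scaleDl span_scale).

Definition module_proj (x : V) : module_quotient :=
  \pi_{ideal_quot (submodule_span G)} x.

End QuotientBySubmodule.

(* The quotient of an algebra by an ideal that is not assumed to be proper,
   as a module. *)
Section QuotientByIdeal.
Variables (k : nzRingType) (B : comAlgType k) (G : set B).

Definition ideal_quotient := {ideal_quot (ideal_span G)}.

Let span_scale (a : k) x : x \in ideal_span G -> a *: x \in ideal_span G.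
Proof. exact: rpredZ. Qed.

HB.instance Definition _ := GRing.Zmodule.on ideal_quotient.
HB.instance Definition _ := GRing.Zmodule_isLmodule.Build k ideal_quotient
  (quot_scaleA span_scale) (quot_scale1 span_scale)
  (quot_scaleDr span_scale) (quot_scaleDl span_scale).

Definition ideal_proj (x : B) : ideal_quotient :=
  \pi_{ideal_quot (ideal_span G)} x.

End QuotientByIdeal.

Section FaceRing.
Variables (k : comNzRingType) (d : Order.disp_t) (S : finBPOrderType d).
Implicit Types I J L M : S.

Definition poly_ring := mpoly.mpoly #|S| k.
HB.instance Definition _ := GRing.ComAlgebra.on poly_ring.

Definition poly_var I : poly_ring :=
  mpoly.mpolyX k (mpoly.mnm1 (enum_rank I)).

Definition face_relation : set poly_ring := [set p |
  [\/ p = poly_var \bot%O - 1,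
      exists I J M, [/\ joins I J <> finset.set0, is_meet I J M
        & p = poly_var I * poly_var J
              - poly_var M * \sum_(L in joins I J) poly_var L]
    | exists I J, joins I J = finset.set0 /\ p = poly_var I * poly_var J]].

Definition face_ideal : {pred poly_ring} := ideal_span face_relation.
HB.instance Definition _ := GRing.ZmodClosed.on face_ideal.

(* The point of the spectrum where only v_0 is nonzero. *)
Definition eval_bot (p : poly_ring) : k :=
  mpoly.meval (fun i => (enum_val i == \bot%O)%:R) p.

Lemma eval_bot_var I : eval_bot (poly_var I) = (I == \bot%O)%:R.
Proof. by rewrite /eval_bot mpoly.mevalXU enum_rankK. Qed.

Lemma joins_bot : joins (\bot%O : S) \bot%O = [set \bot%O]%SET.
Proof.
apply/setP => L; rewrite !inE /upper_bound !le0x /=.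
apply/forallP/eqP => [/(_ \bot%O)|-> L']; first by rewrite !le0x /= => /eqP.
by rewrite !le0x lex0 implybb.
Qed.

Lemma eval_bot_relation p : face_relation p -> eval_bot p = 0.
Proof.
have evB a b : eval_bot (a - b) = eval_bot a - eval_bot b by exact: rmorphB.
have evM a b : eval_bot (a * b) = eval_bot a * eval_bot b by exact: rmorphM.
have ev1 : eval_bot 1 = 1 by exact: rmorph1.
case=> [->|[I [J [M [_ [MI MJ _] ->]]]]|[I [J [IJ ->]]]].
- by rewrite evB ev1 eval_bot_var eqxx subrr.
- rewrite evB !evM !eval_bot_var.
  have -> : eval_bot (\sum_(L in joins I J) poly_var L)
          = \sum_(L in joins I J) (L == \bot%O)%:R.
    rewrite /eval_bot rmorph_sum; apply: eq_bigr => L _.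
    exact: eval_bot_var.
  have [/andP[/eqP I0 /eqP J0]|IJ0] := boolP ((I == \bot%O) && (J == \bot%O)).
    move: MI; rewrite I0 J0 joins_bot lex0 => /eqP ->.
    by rewrite big_set1 !eqxx mulr1 subrr.
  rewrite -natrM mulnb (negPf IJ0) big1 ?mulr0 ?subr0 // => L.
  rewrite inE => /andP[/andP[IL JL] _]; case: eqP => // L0.
  by move: IJ0; rewrite L0 !lex0 in IL JL; rewrite IL JL.
- rewrite evM !eval_bot_var.
  have [I0|_] := eqVneq I \bot%O; last by rewrite mul0r.
  have [J0|_] := eqVneq J \bot%O; last by rewrite mulr0.
  by move/setP: IJ => /(_ \bot%O); rewrite I0 J0 joins_bot !inE eqxx.
Qed.

Lemma face_ideal_closed : idealr_closed face_ideal.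
Proof.
split; [exact: ideal_span0 | | exact: ideal_spanP].
apply/negP => /asboolP[s [sG e]].
suff: (1 : k) = 0 by apply/eqP; exact: oner_neq0.
have <- : eval_bot 1 = 1 by exact: rmorph1.
have -> : eval_bot 1 = \sum_(p <- s) eval_bot (p.1 * p.2).
  by rewrite e; exact: rmorph_sum.
rewrite big_seq big1 // => p /sG /eval_bot_relation p0.
have -> : eval_bot (p.1 * p.2) = eval_bot p.1 * eval_bot p.2.
  exact: rmorphM.
by rewrite p0 mulr0.
Qed.

HB.instance Definition _ := isIdealr.Build poly_ring face_ideal face_ideal_closed.

Definition face_ring := {ideal_quot face_ideal}.
HB.instance Definition _ := GRing.ComNzRing.on face_ring.

Definition face_ring_proj (p : poly_ring) : face_ring :=
  \pi_{ideal_quot face_ideal} p.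

Lemma face_ideal_scale (a : k) x : x \in face_ideal -> a *: x \in face_ideal.
Proof.
move=> xI; rewrite -mulr_algl -[_ * _]addr0.
exact: (ideal_spanP _ xI (ideal_span0 face_relation)).
Qed.

HB.instance Definition _ := GRing.Zmodule_isLmodule.Build k face_ring
  (quot_scaleA face_ideal_scale) (quot_scale1 face_ideal_scale)
  (quot_scaleDr face_ideal_scale) (quot_scaleDl face_ideal_scale).

Lemma face_ring_projM : {morph face_ring_proj : x y / x * y}.
Proof. exact: (rmorphM (\pi_{ideal_quot face_ideal})). Qed.

Lemma face_ring_projZ a : {morph face_ring_proj : x / a *: x}.
Proof. by move=> x; exact: (pi_scale face_ideal_scale). Qed.

Lemma face_ring_projK (x : face_ring) : exists p, face_ring_proj p = x.
Proof. by exists (repr x); exact: reprK. Qed.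

Lemma face_ring_scalerAl (a : k) (x y : face_ring) :
  a *: (x * y) = a *: x * y.
Proof.
have [p <-] := face_ring_projK x; have [q <-] := face_ring_projK y.
by rewrite -face_ring_projM -!face_ring_projZ -face_ring_projM scalerAl.
Qed.

HB.instance Definition _ :=
  GRing.Lmodule_isLalgebra.Build k face_ring face_ring_scalerAl.
HB.instance Definition _ := GRing.Lalgebra_isComAlgebra.Build k face_ring.

Definition face_var I : face_ring := face_ring_proj (poly_var I).

End FaceRing.

Arguments face_ring k {d} S.
Arguments face_var k {d S} I.

Section Presentation.
Variables (k : comNzRingType) (d : Order.disp_t) (S : finBPOrderType d).
Variables (n : nat) (lam : S -> 'I_n -> int) (o : S -> seq S -> bool).
Implicit Types (I J : S) (A : {set 'I_n}).

Definition theta (j : 'I_n) : face_ring k S :=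
  \sum_(i : S | vertex i) (lam i j)%:~R *: face_var k i.

Definition Theta : set (face_ring k S) := range theta.

(* The free module on the symbols [X_I], with basis [face_class]. *)
Definition face_classes := {ffun S -> k^o}.
HB.instance Definition _ := GRing.Lmodule.on face_classes.

Definition face_class I : face_classes := [ffun J => (J == I)%:R].

(* +1 for positive orderings of the vertices of [I], -1 for negative ones. *)
Definition ordering_sign I (s : seq S) : k := (-1) ^+ (~~ o I s).

(* [I : J] for [J < I], [|I| = |J| + 1]; the product does not depend on the
   ordering of the vertices of [J], and when that ordering is positive it is
   the sign of the ordering of [I] starting with the additional vertex. *)
Definition incidence I J : k :=
  let s := enum (vertices J) in
  let i := head I (enum (vertices I :\: vertices J)%SET) in
  ordering_sign I (i :: s) * ordering_sign J s.

(* [j.+1] because columns are numbered from 1. *)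
Definition sgn (A : {set 'I_n}) : k :=
  (-1) ^+ (\sum_(1 <= r < #|~: A|.+1) r + \sum_(j in ~: A) j.+1)%N.

(* [enum_val] enumerates the complement of [A] in increasing order. *)
Definition minor A (s : seq S) : k :=
  \det (\matrix_(a < #|~: A|%SET, b < #|~: A|%SET)
          ((lam (nth \bot%O s a) (enum_val b))%:~R : k)).

(* For [|I| = n - |A|]; the product does not depend on the ordering of the
   vertices of [I], so that any positive ordering gives the same value. *)
Definition orient_coef I A : k :=
  let s := enum (vertices I) in
  ordering_sign I s * sgn A * minor A s.

Definition relation_R J A : face_classes :=
  \sum_(I : S | (J < I)%O && (card_simplex I == (card_simplex J).+1))
     (incidence I J * orient_coef I A) *: face_class I.

(* [|J| = n - q - 1] and [|A| = q] *)
Definition relations : set face_classes := [set x |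
  exists J A, (card_simplex J + #|A| + 1 = n)%N /\ x = relation_R J A].

Definition phi (x : face_classes) : face_ring k S :=
  \sum_(I : S) (x I : k) *: face_var k I.

Lemma phi_is_linear : linear phi.
Proof.
move=> a x y; rewrite /phi scaler_sumr -big_split /=.
by apply: eq_bigr => I _; rewrite !ffunE scalerA -scalerDl.
Qed.

HB.instance Definition _ := GRing.isLinear.Build k face_classes (face_ring k S)
  _ phi phi_is_linear.

Lemma phi_face_class I : phi (face_class I) = face_var k I.
Proof.
rewrite /phi (bigD1 I) //= ffunE eqxx scale1r big1 ?addr0 // => J JI.
by rewrite ffunE (negPf JI) scale0r.
Qed.

End Presentation.

Arguments Theta k {d S n} lam.
Arguments relations k {d S n} lam o.
Arguments phi k {d S} x.
Arguments face_class k {d S} I.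

(* Main.v *)
Require Import Defs.
From HB Require Import structures.
From mathcomp Require Import all_boot all_order all_algebra fingroup perm.
From mathcomp Require Import ring_quotient generic_quotient.
From mathcomp Require Import all_classical all_reals all_analysis complex.
From mathcomp Require Import ring.

Set Implicit Arguments.
Unset Strict Implicit.
Unset Printing Implicit Defensive.

Import Order.TTheory GRing.Theory Num.Theory.
Import numFieldNormedType.Exports.

Local Open Scope classical_set_scope.
Local Open Scope ring_scope.
Local Open Scope quotient_scope.

(* A relation R_{J,A} is, up to sign, the sum over the vertices a outside J of
   <m, lambda_a> v_a v_J, where m is the vector of maximal minors of J, which is
   orthogonal to J; it is the combination of the theta_j with coefficients m_j,
   times v_J.  Injectivity of the map of tori makes the rows lambda_i, i in J,
   part of a basis of Z^n, and then, by expanding a determinant multilinearly,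
   the R_{J,A} span these relations for all m orthogonal to J.

   Let M be the quotient by the R_{J,A}.  A vertex i acts on M by
   v_i [X_J] = sum of the [X_L], L in the join of i and J, if i is not in J, and
   through the linear relation of a dual vector of i in J otherwise.  These
   operators commute and sum_i lambda_{i,j} v_i acts as 0.  Restricting a monomial
   of the face ring to each simplex K gives a monomial x^a; letting x^(a - 1_K)
   act on [X_K], and summing over the K that carry the monomial, defines a linear
   map from k[S] to M that kills Theta and sends v_I to [X_I]: this inverts
   the map induced by phi. *)

(** * Simplices, joins and meets through vertex sets *)

Section SimplicialPosets.
Variables (d : Order.disp_t) (S : finBPOrderType d).
Hypothesis S_simplicial : simplicial_poset S.
Local Open Scope order_scope.
Implicit Types I J K L M i : S.

Lemma in_vertices I i : (i \in vertices I) = vertex i && (i <= I).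
Proof. by rewrite inE. Qed.

Lemma vertex_le i j : vertex i -> vertex j -> (i <= j) = (i == j).
Proof.
move=> /andP[i0 _] /andP[_ /forallP/(_ i)]; rewrite (negPf i0) implybF => ij.
by rewrite le_eqVlt (negPf ij) orbF.
Qed.

Lemma vertices_subset I J : I <= J -> vertices I \subset vertices J.
Proof.
move=> IJ; apply/fintype.subsetP => i; rewrite !in_vertices => /andP[-> /=].
by move/le_trans; apply.
Qed.

Lemma vertices0 : vertices \bot = finset.set0 :> {set S}.
Proof.
apply/setP => i; rewrite in_vertices inE lex0 /vertex.
by case: eqP => //=; rewrite andbF.
Qed.

Lemma vertices_vertex i : vertex i -> vertices i = [set i]%SET.
Proof.
move=> vi; apply/setP => j; rewrite in_vertices inE.
have [vj|nvj] /= := boolP (vertex j); first by rewrite vertex_le.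
by apply/esym/negP => /eqP ji; rewrite ji vi in nvj.
Qed.

(** In the Boolean model of the interval below [K], the element [\bot] has empty image, so the
    minimal nonzero elements are those with singleton image. This identifies the model with subsets
    of [vertices K], after which it is no longer mentioned. *)
Lemma vertex_below K : exists (m : nat) (f : S -> {set 'I_m}),
  [/\ forall x y, x <= K -> y <= K -> (x <= y) = (f x \subset f y),
      forall B, exists2 x, x <= K & f x = B
    & forall i, i <= K -> (vertex i <-> exists x, f i = [set x]%SET)].
Proof.
have [m [f [fle fsurj]]] := S_simplicial K; exists m, f; split=> // i iK.
have f0 : f \bot = finset.set0.
  have [x xK fx] := fsurj finset.set0.
  by apply/eqP; rewrite -finset.subset0 -fx -fle ?le0x.
have f_eq0 x : x <= K -> f x = finset.set0 -> x = \bot.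
  by move=> xK fx; apply/eqP; rewrite -lex0 fle ?le0x // fx f0.
split=> [/andP[i0 /forallP vi]|[x fi]].
  have [fi|[x xi]] := set_0Vmem (f i); first by rewrite (f_eq0 i) ?eqxx in i0.
  have [y yK fy] := fsurj [set x]%SET; exists x.
  have yi : y <= i by rewrite fle // fy finset.sub1set.
  have [<- //|yni] := eqVneq y i.
  have := vi y; rewrite lt_neqAle yni yi /= => /eqP y0.
  by move: fy; rewrite y0 f0 => /setP/(_ x); rewrite !inE eqxx.
apply/andP; split.
  by apply/eqP => i0; move: fi; rewrite i0 f0 => /setP/(_ x); rewrite !inE eqxx.
apply/forallP => y; apply/implyP; rewrite lt_neqAle => /andP[yi leyi].
have yK := le_trans leyi iK; apply/eqP/f_eq0 => //.
move: leyi yi; rewrite fle // fi finset.subset1 => /orP[/eqP fy /eqP[]|/eqP //].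
by apply: le_anti; rewrite (fle y i) // (fle i y) // fi fy subxx.
Qed.

(** The common upper bound [K] matters: distinct simplices of a simplicial poset may have the same
    vertices. *)
Lemma le_vertices K I J : I <= K -> J <= K ->
  (I <= J) = (vertices I \subset vertices J).
Proof.
move=> IK JK; apply/idP/idP => [|/fintype.subsetP IJ]; first exact: vertices_subset.
have [m [f [fle fsurj fv]]] := vertex_below K.
rewrite fle //; apply/fintype.subsetP => x xI.
have [i iK fi] := fsurj [set x]%SET.
have : i \in vertices J.
  apply: IJ; rewrite in_vertices fle // fi finset.sub1set xI andbT.
  by apply/fv => //; exists x.
by rewrite in_vertices fle // fi finset.sub1set => /andP[].
Qed.

Lemma vertices_inj K I J : I <= K -> J <= K -> vertices I = vertices J -> I = J.
Proof.
move=> IK JK e; apply: le_anti.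
by rewrite (le_vertices IK JK) (le_vertices JK IK) e subxx.
Qed.

Lemma face_of_vertices K (B : {set S}) : B \subset vertices K ->
  exists2 I, I <= K & vertices I = B.
Proof.
move=> /fintype.subsetP BK; have [m [f [fle fsurj fv]]] := vertex_below K.
have [I IK fI] := fsurj (\bigcup_(i in B) f i)%SET.
exists I => //; apply/setP => i; rewrite in_vertices.
apply/andP/idP => [[vi iI]|iB]; last first.
  have := BK _ iB; rewrite in_vertices => /andP[vi iK]; split=> //.
  by rewrite fle // fI; apply: finset.bigcup_sup.
have iK := le_trans iI IK; have [x fi] := (fv i iK).1 vi.
move: iI; rewrite fle // fI fi finset.sub1set => /finset.bigcupP[j jB xj].
have := BK _ jB; rewrite in_vertices => /andP[vj jK].
have [y fj] := (fv j jK).1 vj.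
suff <- : j = i by [].
move: xj; rewrite fj inE => /eqP xy.
by apply: le_anti; rewrite (fle i j) // (fle j i) // fi fj xy subxx.
Qed.

(** The face of [L] on the union of the two vertex sets is already an upper bound, so a minimal
    upper bound has no further vertices. *)
Lemma in_joins I J L : (L \in joins I J) =
  [&& I <= L, J <= L & vertices L == (vertices I :|: vertices J)%SET].
Proof.
rewrite inE /upper_bound -andbA; apply/and3P/and3P => [] [IL JL].
  move=> /forallP minL; split=> //.
  have [|N NL vN] := @face_of_vertices L (vertices I :|: vertices J).
    by rewrite finset.subUset !vertices_subset.
  have := minL N; rewrite NL (le_vertices IL NL) (le_vertices JL NL) vN.
  by rewrite finset.subsetUl finset.subsetUr => /eqP <-; rewrite vN.
move=> /eqP vL; split=> //; apply/forallP => N; apply/implyP.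
move=> /andP[/andP[IN JN] NL]; apply/eqP/le_anti; rewrite NL /=.
by rewrite (le_vertices (lexx L) NL) vL finset.subUset !vertices_subset.
Qed.

Lemma vertices_meet I J L M : I <= L -> J <= L -> is_meet I J M ->
  vertices M = (vertices I :&: vertices J)%SET.
Proof.
move=> IL JL [MI MJ minM]; apply/eqP; rewrite finset.eqEsubset finset.subsetI.
rewrite !vertices_subset //=.
have [|N NL vN] := @face_of_vertices L (vertices I :&: vertices J).
  by apply: fintype.subset_trans (vertices_subset IL); exact: finset.subsetIl.
rewrite -vN; apply/vertices_subset/minM.
  by rewrite (le_vertices NL IL) vN finset.subsetIl.
by rewrite (le_vertices NL JL) vN finset.subsetIr.
Qed.

Lemma meet_exists I J L : I <= L -> J <= L -> exists M, is_meet I J M.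
Proof.
move=> IL JL.
have [|M ML vM] := @face_of_vertices L (vertices I :&: vertices J).
  by apply: fintype.subset_trans (vertices_subset IL); exact: finset.subsetIl.
exists M; split.
- by rewrite (le_vertices ML IL) vM finset.subsetIl.
- by rewrite (le_vertices ML JL) vM finset.subsetIr.
move=> N NI NJ; rewrite (le_vertices (le_trans NI IL) ML) vM finset.subsetI.
by rewrite !vertices_subset.
Qed.

(** The join below [K] is the face of [K] on the union of vertices. Its uniqueness lets a sum over
    [joins] be exchanged with a sum over simplices above both arguments. *)
Lemma joins_sub_unique I J K : I <= K -> J <= K ->
  exists2 L, L \in joins I J & L <= K /\
    forall L', L' \in joins I J -> L' <= K -> L' = L.
Proof.
move=> IK JK; have [|L LK vL] := @face_of_vertices K (vertices I :|: vertices J).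
  by rewrite finset.subUset !vertices_subset.
exists L.
  rewrite in_joins (le_vertices IK LK) (le_vertices JK LK) vL.
  by rewrite finset.subsetUl finset.subsetUr eqxx.
split=> // L'; rewrite in_joins => /and3P[_ _ /eqP vL'] L'K.
by apply: (@vertices_inj K) => //; rewrite vL vL'.
Qed.

End SimplicialPosets.

(** * Injective maps of tori and integral right inverses *)

Section CharacteristicMatrix.
Variable R : realType.
Local Notation C := (complexes R).

(** For [m = 0] the number -1 serves. Otherwise take a root of 1 + z + ... + z^(m-1); it differs
    from 1, where this polynomial has the nonzero value m. *)
Lemma circle_root_of_unity (m : nat) : m != 1%N ->
  exists2 z : C, circle z & z != 1 /\ z ^+ m = 1.
Proof.
case: m => [|[|m]] // _.
  exists (-1); first by rewrite /circle /= normrN1.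
  by split; rewrite ?expr0 // eq_sym -subr_eq0 opprK -mulr2n pnatr_eq0.
have [|z pz] := closed_rootP
    (\poly_(j < m.+2) (1 : complex R)) _.
  by rewrite size_poly_eq ?oner_eq0.
have {pz} : \sum_(j < m.+2) z ^+ j = 0.
  move: pz; rewrite /root horner_poly => /eqP {2}<-.
  by apply: eq_bigr => j _; rewrite mul1r.
move=> pz; have zm : z ^+ m.+2 = 1.
  by apply/eqP; rewrite -subr_eq0 subrX1 pz mulr0.
exists (z : C).
  have : `|(z : C)| ^+ m.+2 = 1 by rewrite -normrX zm normr1.
  by move/eqP; rewrite pexpr_eq1 // => /eqP.
split=> //; apply/eqP => z1; move: pz; rewrite z1.
under eq_bigr do rewrite expr1n.
by rewrite sumr_const card_ord => /eqP; rewrite pnatr_eq0.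
Qed.

Lemma circle_neq0 (z : C) : circle z -> z != 0.
Proof. by move=> z1; rewrite -normr_gt0 z1. Qed.

Lemma prodr_exprz (I : finType) (z : C) (u : I -> int) : z != 0 ->
  \prod_i z ^ u i = z ^ (\sum_i u i).
Proof.
move=> z0; elim/big_rec2: _ => [|i x y _ ->]; first by rewrite expr0z.
by rewrite expfzDr.
Qed.

(* If a diagonal entry e of the Smith form L D P is not a unit, a nontrivial
   root of unity of order dividing e, raised to a row of L^-1, is in the kernel. *)
Lemma torus_injective_right_inverse (s n : nat) (M : 'M[int]_(s, n)) :
  (forall z : 'I_s -> C, (forall i, circle (z i)) ->
     (forall j, \prod_i z i ^ M i j = 1) -> forall i, z i = 1) ->
  exists G : 'M[int]_(n, s), M *m G = 1%:M.
Proof.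
move=> injM; have [L uL [P uP [e _ defM]]] := int_Smith_normal_form M.
have e_unit (p : 'I_s) : (p < n)%N && (e`_p \is a GRing.unit).
  apply/negPn/negP => np.
  (* A row beyond the last column is treated as having diagonal entry 0. *)
  pose c := if (p < n)%N then e`_p else 0.
  have c1 : `|c|%N != 1%N.
    move: np; rewrite /c; case: ltnP => //= _.
    apply: contra => /eqP e1.
    by move: e1; case: (e`_p) => [[|[|a]]|[|a]].
  have [z z1 [zn1 zc]] := circle_root_of_unity c1.
  have z0 := circle_neq0 z1.
  have {}zc : z ^ c = 1.
    by case: (c) zc => a /= za; rewrite ?NegzE -?exprnP -?exprnN ?za ?invr1.
  pose u := row p (invmx L).
  have uM j : exists t, (u *m M) 0 j = c * t.
    have -> : u *m M = row p (invmx L *m M) by rewrite row_mul.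
    rewrite defM !mulmxA mulVmx // mul1mx mxE.
    rewrite mxE; under eq_bigr do rewrite mxE.
    rewrite /c; case: ltnP => [pn|np'].
      exists (P (Ordinal pn) j); rewrite (bigD1 (Ordinal pn)) //= eqxx mulr1n.
      rewrite big1 ?addr0 // => i ip; rewrite eq_sym.
      by rewrite (_ : (i == p :> nat) = false) ?mul0r //; apply: negbTE ip.
    exists 0; rewrite mulr0 big1 // => i _.
    by rewrite gtn_eqF ?mul0r //; apply: leq_trans (ltn_ord i) np'.
  have zu i : z ^ u 0 i = 1.
    apply: (injM (fun i => z ^ u 0 i)) => [{}i|j].
      rewrite /circle /=; case: (u 0 i) => a; rewrite ?NegzE -?exprnP -?exprnN.
        by rewrite normrX z1 expr1n.
      by rewrite normfV normrX z1 expr1n invr1.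
    under eq_bigr do rewrite exprz_exp.
    rewrite prodr_exprz //; have [t] := uM j; rewrite mxE => ->.
    by rewrite -exprz_exp zc exp1rz.
  (* All the powers z^(u_i) are 1, and the exponents u_i pair to 1 with column [p] of [L]; hence z =
     1, a contradiction. *)
  have uL1 : \sum_i u 0 i * L i p = 1.
    have : (invmx L *m L) p p = 1 by rewrite mulVmx // mxE eqxx.
    by rewrite mxE => <-; apply: eq_bigr => i _; rewrite mxE.
  have := prodr_exprz (fun i => u 0 i * L i p) z0; rewrite uL1.
  rewrite big1 => [e1|i _]; first by move: zn1; rewrite -[z]expr1z -e1 eqxx.
  by rewrite -exprz_exp zu exp1rz.
exists (invmx P *m (\matrix_(j < n, i < s) ((e`_i)^-1 *+ (j == i :> nat))) *m invmx L).
rewrite defM !mulmxA mulmxK // -[X in X *m invmx L]mulmxA.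
rewrite [X in L *m X](_ : _ = 1%:M) ?mulmx1 ?mulmxV //.
apply/matrixP => i k; rewrite !mxE.
have /andP[ilt ei] := e_unit i.
rewrite (bigD1 (Ordinal ilt)) //= big1 => [|j ji].
  rewrite addr0 !mxE /= eqxx mulr1n -(inj_eq val_inj) /=.
  by case: eqP => [->|]; rewrite ?mulr0 // mulr1n mulrV //; have /andP[] := e_unit k.
rewrite !mxE eq_sym (_ : (j == i :> nat) = false) ?mul0r //.
by apply: negbTE ji.
Qed.

End CharacteristicMatrix.

(** * Vectors dual to the characteristic vectors of a simplex *)

Definition weight (k : comNzRingType) (S : Type) (n : nat)
    (lam : S -> 'I_n -> int) (m : 'I_n -> k) (a : S) : k :=
  \sum_j m j * (lam a j)%:~R.

(** The face [F K] is nonempty and lies in each of these facets. This is what makes the condition on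
    the characteristic function available for [vertices K]. *)
Lemma faces_of_simplex_meet (R : realType) (n : nat) (Q : topologicalType)
    (atlas : set (chart R n Q)) (d : Order.disp_t) (S : finBPOrderType d)
    (F : S -> set Q) (K : S) : is_face_poset atlas F ->
  \bigcap_(i in [set` vertices K]) F i !=set0.
Proof.
case=> Fface _ Fle; have [c [p pc FK]] := Fface K; exists p => i /=.
rewrite in_vertices => /andP[_ /Fle]; apply; rewrite FK.
exact/subset_closure/connected_component_refl.
Qed.

Section DualVectors.
Variables (k : comNzRingType) (R : realType) (n : nat) (d : Order.disp_t).
Variables (S : finBPOrderType d) (T : S -> set 'rV[complexes R]_n).
Variables (lam : S -> 'I_n -> int).
Hypothesis lam_generator : forall i : S, vertex i -> toric_generator (T i) (lam i).
Local Notation C := (complexes R).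

(** Injectivity on tori gives the integer matrix with rows lambda_i, i in [K], a right inverse; its
    columns, mapped to [k], are the dual vectors. *)
Lemma dual_vectors (K : S) : product_injective T (vertices K) ->
  exists g : S -> 'I_n -> k, forall i j,
    i \in vertices K -> j \in vertices K -> weight lam (g i) j = (i == j)%:R.
Proof.
move=> injT; pose s := #|vertices K|.
pose M : 'M[int]_(s, n) := \matrix_(i, j) lam (enum_val i) j.
have [z z1 Mz i|G MG] := @torus_injective_right_inverse R s n M.
  (* Families of torus elements are indexed by all of [S], so [z] is extended by 1. *)
  pose zz (a : S) : C :=
    if [pick i : 'I_s | enum_val i == a] is Some i then z i else 1.
  have zzE l : zz (enum_val l) = z l.
    rewrite /zz; case: pickP => [l' /eqP/enum_val_inj -> //|/(_ l)].
    by rewrite eqxx.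
  have zz1 a : circle (zz a).
    by rewrite /zz; case: pickP => // _; rewrite /circle /= normr1.
  have vK l : l \in vertices K -> vertex l by rewrite in_vertices => /andP[].
  have one1 : circle (1 : C) by rewrite /circle /= normr1.
  have inP (y : S -> C) : (forall a, circle (y a)) ->
      in_product T (vertices K) (fun a => loop (lam a) (y a)).
    by move=> y1 a /vK va; rewrite (lam_generator va).2; exists (y a).
  (* The family is compared with the trivial one; the assumption on [z] says that both have product
     1. *)
  have e := injT _ _ (inP zz zz1) (inP (fun=> 1) (fun=> one1)).
  have iK : enum_val i \in vertices K by exact: enum_valP.
  rewrite -zzE; apply: (lam_generator (vK _ iK)).1 => //.
  apply: e iK; apply/rowP => j; rewrite !mxE.
  rewrite [RHS]big1 => [|a _]; last by rewrite mxE exp1rz.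
  rewrite big_enum_val /= -[RHS](Mz j); apply: eq_bigr => l _.
  by rewrite !mxE zzE.
pose rk (a : S) := [pick i : 'I_s | enum_val i == a].
have rkP a : a \in vertices K -> exists2 i : 'I_s, rk a = Some i & enum_val i = a.
  move=> aK; rewrite /rk; case: pickP => [i /eqP ia|/(_ (enum_rank_in aK a))].
    by exists i.
  by rewrite enum_rankK_in ?eqxx.
exists (fun a j => (if rk a is Some i then G j i else 0)%:~R) => a b aK bK.
have [i -> ia] := rkP a aK; have [l _ lb] := rkP b bK.
have := congr1 (fun X : 'M[int]_s => (X l i)%:~R : k) MG; rewrite !mxE rmorph_sum /=.
rewrite -ia -lb (inj_eq enum_val_inj) => e.
transitivity (((l == i)%:R : int)%:~R : k); last by rewrite eq_sym; case: (i == l).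
rewrite -e; apply: eq_bigr => j _.
by rewrite mxE rmorphM mulrC.
Qed.

End DualVectors.

(** * Determinants of products and minors in chosen columns *)

Lemma det_mulmx_columns (k : comNzRingType) (p n : nat)
    (M : 'M[k]_(p, n)) (G : 'M[k]_(n, p)) :
  \det (M *m G) = \sum_(f : {ffun 'I_p -> 'I_n})
    (\prod_i G (f i) i) * \det (\matrix_(a, b) M a (f b)).
Proof.
rewrite -det_tr trmx_mul; under [RHS]eq_bigr do rewrite -det_tr.
rewrite /determinant.
(* Each column of the product is a combination of columns of [M]; distributing the product over
   these sums gives an expansion over all maps [f], with repeated columns still present. *)
transitivity (\sum_(s : 'S_p) \sum_(f : {ffun 'I_p -> 'I_n})
    (-1) ^+ s * \prod_i (G (f i) i * M (s i) (f i))).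
  apply: eq_bigr => s _; rewrite -big_distrr /=; congr (_ * _).
  rewrite -(bigA_distr_bigA (fun i j => G j i * M (s i) j)) /=.
  apply: eq_bigr => i _; rewrite mxE; apply: eq_bigr => j _.
  by rewrite !mxE.
rewrite exchange_big; apply: eq_bigr => f _ /=.
rewrite mulr_sumr; apply: eq_bigr => s _.
rewrite big_split /= mulrCA; congr (_ * (_ * _)).
by apply: eq_bigr => i _; rewrite !mxE.
Qed.

Section ColumnMinors.
Variables (k : comNzRingType) (d : Order.disp_t) (S : finBPOrderType d).
Variables (n : nat) (lam : S -> 'I_n -> int).
Implicit Types (s : seq S) (x : S).

(** Columns are given by a map and not by a subset, because the multilinear expansion of a
    determinant produces columns in any order and with repetitions. *)
Definition column_minor p (f : 'I_p -> 'I_n) s : k :=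
  \det (\matrix_(a < p, b < p) (lam (nth \bot%O s a) (f b))%:~R).

(** Expand along the first row and collect the cofactors by column of lambda. *)
Lemma column_minor_weight p (f : 'I_p -> 'I_n) s : (0 < p)%N ->
  exists m, forall x, column_minor f (x :: s) = weight lam m x.
Proof.
case: p f => // p f _.
pose A x : 'M[k]_p.+1 :=
  \matrix_(a < p.+1, b < p.+1) (lam (nth \bot%O (x :: s) a) (f b))%:~R.
(* The cofactors of row 0 do not see the head of the list, so [\bot] is a mere placeholder. *)
exists (fun j => \sum_(b | f b == j) cofactor (A \bot%O) 0 b) => x.
transitivity (\sum_b cofactor (A \bot%O) 0 b * (lam x (f b))%:~R).
  rewrite /column_minor -/(A x) (expand_det_row _ 0).
  apply: eq_bigr => b _; rewrite mulrC [A x 0 b]mxE; congr (_ * _).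
  rewrite /cofactor; congr (_ * \det _); apply/matrixP => i j.
  by rewrite !mxE.
rewrite (partition_big f xpredT) //=; apply: eq_bigr => j _.
by rewrite mulr_suml; apply: eq_bigr => b /eqP ->.
Qed.

(** Two rows coincide, and the bound on [size s] keeps the second one inside the matrix. This makes
    the vector of minors orthogonal to [s]. *)
Lemma column_minor_repeat p (f : 'I_p -> 'I_n) s x :
  (size s < p)%N -> x \in s -> column_minor f (x :: s) = 0.
Proof.
move=> sp xs; have ip : ((index x s).+1 < p)%N.
  by apply: leq_trans sp; rewrite ltnS index_mem.
pose i0 := Ordinal (ltn_trans (ltn0Sn _) ip).
apply: (@determinant_alternate _ _ _ i0 (Ordinal ip)) => // b.
by rewrite !mxE /= nth_index.
Qed.

Lemma column_minor_noninjective p (f : 'I_p -> 'I_n) s :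
  ~~ injectiveb f -> column_minor f s = 0.
Proof.
move=> /injectivePn[b [b' bb' fb]]; rewrite /column_minor -det_tr.
by apply: (@determinant_alternate _ _ _ b b') => // a; rewrite !mxE fb.
Qed.

Lemma column_minor_perm p (f : 'I_p -> 'I_n) s (q : 'S_(size s)) :
  size s = p -> column_minor f (reorder q) = (-1) ^+ q * column_minor f s.
Proof.
move=> sp; subst p; rewrite /column_minor -det_perm -det_mulmx -row_permE.
congr (\det _); apply/matrixP => a b; rewrite !mxE.
rewrite /reorder (nth_map a) ?size_enum_ord // nth_ord_enum.
by rewrite (tnth_nth \bot%O).
Qed.

Lemma column_minor_reindex p p' (f : 'I_p -> 'I_n) (h : 'I_p' -> 'I_n) :
  p = p' -> injective f -> injective h -> (forall b, exists b', f b' = h b) ->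
  exists e : bool, forall s, column_minor f s = (-1) ^+ e * column_minor h s.
Proof.
move=> pp; subst p' => f_inj h_inj fh.
have sig b : {b' | f b' == h b}.
  by apply: sigW; have [b' <-] := fh b; exists b'.
have sigK b : f (sval (sig b)) = h b by apply/eqP; exact: svalP (sig b).
have sig_inj : injective (fun b => sval (sig b)).
  by move=> b b' e; apply: h_inj; rewrite -!sigK e.
pose q := perm sig_inj; exists q => s.
have -> : column_minor h s = \det (\matrix_(a, b) (lam (nth \bot%O s a) (f b))%:~R
    *m perm_mx q^-1).
  rewrite -col_permE; congr (\det _); apply/matrixP => a b.
  by rewrite !mxE permE sigK.
by rewrite det_mulmx det_perm odd_permV mulrCA -signr_addb addbb mulr1.
Qed.

End ColumnMinors.

(** * The span of the relations R_{J,A} *)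

Section LinearRelations.
Variables (k : comNzRingType) (d : Order.disp_t) (S : finBPOrderType d).
Variables (n : nat) (lam : S -> 'I_n -> int) (o : S -> seq S -> bool).
Hypothesis S_simplicial : simplicial_poset S.
Hypothesis o_orientation : is_orientation o.
Implicit Types (I J K L : S) (A : {set 'I_n}) (m : 'I_n -> k).

(** Stands for the product v_I v_J when the two simplices share no vertex. *)
Definition join_sum I J : face_classes k S := \sum_(L in joins I J) face_class k L.

(* For [m] orthogonal to [J], the class of v_J * sum_j m_j theta_j. *)
Definition linear_relation m J : face_classes k S :=
  \sum_(a : S | vertex a && ~~ (a <= J)%O) weight lam m a *: join_sum a J.

Definition orthogonal_to J m := forall i, i \in vertices J -> weight lam m i = 0.

(** Sorts the cofaces of [J] by their additional vertex, in the form used by [incidence]. The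
    difference of vertex sets is a singleton, so the default of [head] never occurs. *)
Lemma in_joins_vertex a J L : vertex a -> ~~ (a <= J)%O ->
  (L \in joins a J) = [&& (J < L)%O, card_simplex L == (card_simplex J).+1
                        & head L (enum (vertices L :\: vertices J)%SET) == a].
Proof.
move=> va aJ; rewrite in_joins // (vertices_vertex va).
have aNJ : a \notin vertices J by rewrite in_vertices va.
apply/and3P/and3P => [[aL JL /eqP vL]|[JL /eqP cL /eqP hL]].
  split.
  - rewrite lt_neqAle JL andbT; apply: contraNneq aJ => ->; exact: aL.
  - by rewrite /card_simplex vL cardsU1 aNJ.
  have -> : (vertices L :\: vertices J)%SET = [set a]%SET.
    apply/setP => b; rewrite vL !inE -!in_vertices.
    by case: eqP => [->|_]; rewrite ?(negPf aNJ) //= ?andNb.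
  by rewrite enum_set1.
have sJL := vertices_subset (ltW JL).
have /eqP c1 : #|(vertices L :\: vertices J)%SET| == 1%N.
  rewrite cardsD (finset.setIidPr sJL) -/(card_simplex L) cL.
  by rewrite -/(card_simplex J) subSnn.
move/eqP/cards1P: c1 => [b vb]; move: hL; rewrite vb enum_set1 /= => ba; subst b.
have aL : a \in vertices L.
  by have : a \in [set a]%SET; [rewrite inE | rewrite -vb inE => /andP[]].
split; [by move: aL; rewrite in_vertices => /andP[] | exact: ltW |].
by rewrite -vb finset.setUC -{1}(finset.setIidPr sJL) finset.setID.
Qed.

Lemma sum_over_cofaces (c : S -> k) J :
  \sum_(I : S | (J < I)%O && (card_simplex I == (card_simplex J).+1))
     c I *: face_class k I =
  \sum_(a : S | vertex a && ~~ (a <= J)%O)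
     \sum_(L in joins a J) c L *: face_class k L.
Proof.
rewrite (partition_big (fun I => head I (enum (vertices I :\: vertices J)%SET))
  (fun a => vertex a && ~~ (a <= J)%O)) /=.
  apply: eq_bigr => a /andP[va aJ]; apply: eq_bigl => L.
  by rewrite in_joins_vertex // andbA.
move=> I /andP[JI /eqP cI].
have : (0 < #|(vertices I :\: vertices J)%SET|)%N.
  rewrite cardsD (finset.setIidPr (vertices_subset (ltW JI))).
  by rewrite subn_gt0 -/(card_simplex I) cI.
rewrite cardE; case e : (enum _) => [|a s] //= _.
have : a \in (vertices I :\: vertices J)%SET by rewrite -mem_enum e inE eqxx.
by rewrite inE !in_vertices => /andP[+ /andP[va _]]; rewrite va.
Qed.

Lemma is_ordering_enum I : is_ordering I (enum (vertices I)).
Proof. by split; [exact: enum_uniq | move=> i; rewrite mem_enum]. Qed.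

(** Reordering the rows multiplies the minor and the orientation sign by the same sign. *)
Lemma oriented_column_minor p (f : 'I_p -> 'I_n) I s t :
  is_ordering I s -> is_ordering I t -> size s = p ->
  ordering_sign k o I t * ordering_sign k o I s * column_minor k lam f s =
  column_minor k lam f t.
Proof.
move=> [us Is] [ut It] sp.
have /tuple_permP[q] : perm_eq t (in_tuple s).
  by apply: uniq_perm => // i; rewrite Is It.
rewrite (_ : tval _ = reorder q) => [->|]; last first.
  by rewrite /reorder.
rewrite column_minor_perm //; congr (_ * _).
rewrite /ordering_sign (o_orientation.2 I s q) //.
rewrite -signr_addb; congr (_ ^+ (nat_of_bool _)).
by case: (o I s); case: (odd_perm q).
Qed.

Lemma card_complement J A : (card_simplex J + #|A| + 1 = n)%N ->
  (card_simplex J).+1 = #|~: A|%SET.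
Proof.
move=> cJA; have := cardsC A; rewrite card_ord => cA.
by apply: (@addnI #|A|); rewrite cA addnS addnC -addn1.
Qed.

Definition relation_sign J A : k := ordering_sign k o J (enum (vertices J)) * sgn k A.

(** The two orientation signs of a coface, one from [incidence] and one from [orient_coef], convert
    the minor of its enumeration into the one with the additional vertex first. What remains is a
    sign depending on [J] and [A] only. *)
Lemma relation_R_column_minor J A : (card_simplex J + #|A| + 1 = n)%N ->
  relation_R k lam o J A = relation_sign J A *:
    \sum_(a : S | vertex a && ~~ (a <= J)%O)
      column_minor k lam (@enum_val _ (mem (~: A)%SET)) (a :: enum (vertices J))
        *: join_sum a J.
Proof.
move=> cJA; rewrite /relation_R sum_over_cofaces scaler_sumr.
apply: eq_bigr => a /andP[va aJ]; rewrite scalerA scaler_sumr.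
apply: eq_bigr => L; rewrite in_joins_vertex // => /and3P[JL /eqP cL /eqP hL].
congr (_ *: _); rewrite /incidence /orient_coef.
rewrite hL; set s := enum (vertices J); set t := enum (vertices L).
have st : is_ordering L (a :: s).
  have : L \in joins a J by rewrite in_joins_vertex // JL cL hL !eqxx.
  rewrite in_joins // => /and3P[_ _ /eqP vL].
  split; first by rewrite /= enum_uniq mem_enum in_vertices va aJ.
  by move=> b; rewrite vL (vertices_vertex va) !inE mem_enum inE.
have := oriented_column_minor (@enum_val _ (mem (~: A)%SET))
  (is_ordering_enum L) st _.
rewrite -/t => <-; last first.
  by rewrite /t -cardE -/(card_simplex L) cL (card_complement cJA).
rewrite /relation_sign -/s /minor -/(column_minor k lam _ _).
ring.
Qed.

Lemma weightZ c m a : weight lam (fun j => c * m j) a = c * weight lam m a.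
Proof. by rewrite mulr_sumr; apply: eq_bigr => j _; rewrite mulrA. Qed.

Lemma relation_signK J A : relation_sign J A * relation_sign J A = 1.
Proof.
by rewrite /relation_sign /ordering_sign /sgn -!exprD addnn -signr_odd odd_double.
Qed.

(** The minors are linear in the row of the additional vertex, which provides [m], and vanish when
    this row repeats one of [J], which gives orthogonality. *)
Lemma relation_R_linear J A : (card_simplex J + #|A| + 1 = n)%N ->
  exists m, orthogonal_to J m /\ relation_R k lam o J A = linear_relation m J.
Proof.
move=> cJA; have cA := card_complement cJA.
have [|m mE] := @column_minor_weight k d S n lam _
    (@enum_val _ (mem (~: A)%SET)) (enum (vertices J)).
  by rewrite -cA.
exists (fun j => relation_sign J A * m j); split.
  move=> i iJ; rewrite weightZ -mE column_minor_repeat ?mulr0 ?mem_enum //.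
  by rewrite -cA -cardE.
rewrite relation_R_column_minor // scaler_sumr; apply: eq_bigr => a _.
by rewrite weightZ mE scalerA.
Qed.

(** Repeated columns give zero; distinct columns form the complement of some [A] and give
    [relation_R] for [J] and [A] up to sign. *)
Lemma column_relation_span J (f : 'I_(card_simplex J).+1 -> 'I_n) :
  \sum_(a : S | vertex a && ~~ (a <= J)%O)
     column_minor k lam f (a :: enum (vertices J)) *: join_sum a J
  \in submodule_span (relations k lam o).
Proof.
have [/injectiveP f_inj|f_ninj] := boolP (injectiveb f); last first.
  rewrite big1 ?rpred0 // => a _.
  by rewrite column_minor_noninjective // scale0r.
pose A := (~: [set f b | b in 'I_(card_simplex J).+1])%SET.
have cA : #|~: A|%SET = (card_simplex J).+1.
  by rewrite finset.setCK card_imset // card_ord.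
have cJA : (card_simplex J + #|A| + 1 = n)%N.
  have := cardsC A; rewrite card_ord cA => An; apply: etrans An.
  by rewrite addn1 addnS addnC.
have fA (b : 'I_#|~: A|%SET) : exists b', f b' = enum_val b.
  move: (enum_val b) (enum_valP b) => j; rewrite finset.setCK.
  move=> /finset.imsetP[b' _ ->].
  by exists b'.
have [e fE] := column_minor_reindex k lam (esym cA) f_inj (@enum_val_inj _ _) fA.
suff -> : \sum_(a : S | vertex a && ~~ (a <= J)%O)
     column_minor k lam f (a :: enum (vertices J)) *: join_sum a J =
   ((-1) ^+ e * relation_sign J A) *: relation_R k lam o J A.
  apply: rpredZ; apply/asboolP; exists [:: (1, relation_R k lam o J A)].
  split; last by rewrite big_seq1 scale1r.
  by move=> p; rewrite inE => /eqP ->; exists J, A.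
rewrite relation_R_column_minor // scalerA -mulrA relation_signK mulr1.
rewrite scaler_sumr; apply: eq_bigr => a _.
by rewrite fE scalerA.
Qed.

(** The weight of x is the determinant of the rows x, [J] paired with the columns [m] and the dual
    vectors of [J]: below its first entry the first column is zero by orthogonality, and the
    remaining block is the identity. Expanding this determinant over columns reduces the claim to
    [column_relation_span]. *)
Lemma linear_relation_span J m (g : S -> 'I_n -> k) :
  (forall i j, i \in vertices J -> j \in vertices J ->
     weight lam (g i) j = (i == j)%:R) ->
  orthogonal_to J m -> linear_relation m J \in submodule_span (relations k lam o).
Proof.
move=> dual mJ; set N := (card_simplex J).
pose s := enum (vertices J).
have sN : size s = N by rewrite /s -cardE.
have nthJ (i : nat) : (i < N)%N -> nth \bot%O s i \in vertices J.
  by rewrite -sN => iN; rewrite -mem_enum mem_nth.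
pose G : 'M[k]_(n, N.+1) := \matrix_(j, b)
  (if unlift 0 b is Some b' then g (nth \bot%O s b') j else m j).
pose M x : 'M[k]_(N.+1, n) := \matrix_(a, j) (lam (nth \bot%O (x :: s) a) j)%:~R.
have wE x : weight lam m x = \sum_(f : {ffun 'I_N.+1 -> 'I_n})
    (\prod_i G (f i) i) * column_minor k lam f (x :: s).
  transitivity (\det (M x *m G)).
    rewrite (expand_det_col _ 0) (bigD1 0) //= big1 => [|i i0].
      rewrite addr0 mxE (_ : \sum_j _ = weight lam m x); last first.
        by apply: eq_bigr => j _; rewrite !mxE unlift_none mulrC.
      rewrite /cofactor addn0 expr0 mul1r (_ : row' _ _ = 1%:M) ?det1 ?mulr1 //.
      apply/matrixP => a b; rewrite !mxE.
      transitivity (weight lam (g (nth \bot%O s b)) (nth \bot%O s a)).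
        by apply: eq_bigr => j _; rewrite !mxE liftK mulrC.
      rewrite dual ?nthJ // nth_uniq ?sN ?enum_uniq // eq_sym.
      by rewrite -(inj_eq val_inj).
    rewrite mxE (_ : \sum_j _ = weight lam m (nth \bot%O (x :: s) i)).
      case: (unliftP 0 i) i0 => [a ->|->]; last by rewrite eqxx.
      move=> _ /=; rewrite mJ ?mul0r //; apply: nthJ; exact: ltn_ord a.
    by apply: eq_bigr => j _; rewrite !mxE unlift_none mulrC.
  rewrite det_mulmx_columns; apply: eq_bigr => f _; congr (_ * \det _).
  by apply/matrixP => a b; rewrite !mxE.
rewrite /linear_relation; under eq_bigr do rewrite wE scaler_suml.
rewrite exchange_big /=; apply: rpred_sum => f _.
under eq_bigr do rewrite -scalerA.
by rewrite -scaler_sumr; apply/rpredZ/column_relation_span.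
Qed.

End LinearRelations.

(** * Commuting vertex operators on the quotient by the relations *)

Lemma face_classes_sum (k : comNzRingType) (d : Order.disp_t)
    (S : finBPOrderType d) (x : face_classes k S) :
  x = \sum_J x J *: face_class k J.
Proof.
apply/ffunP => I; rewrite sum_ffunE (bigD1 I) //= big1 => [|J JI].
  by rewrite !ffunE eqxx addr0; exact: esym (mulr1 _).
by rewrite !ffunE eq_sym (negPf JI); exact: mulr0.
Qed.

(** Each [N] on the right contains exactly one join of [a] and [J]. The condition on [N] is
    symmetric in [i] and [a], which is the source of commutativity. *)
Lemma joins_joins_sum (d : Order.disp_t) (S : finBPOrderType d)
    (V : nmodType) (c : S -> V) (a i J : S) : simplicial_poset S ->
  \sum_(L in joins a J) \sum_(N in joins i L) c N =
  \sum_(N : S | [&& i <= N, a <= N, J <= N &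
     vertices N == (vertices i :|: (vertices a :|: vertices J))%SET]%O) c N.
Proof.
move=> S_simplicial.
rewrite (exchange_big_dep (fun N => [&& i <= N, a <= N, J <= N &
     vertices N == (vertices i :|: (vertices a :|: vertices J))%SET]%O)) /=.
  apply: eq_bigr => N /and4P[iN aN JN /eqP vN].
  have [L LaJ [LN Luniq]] := joins_sub_unique S_simplicial aN JN.
  rewrite (big_pred1 L) // => L' /=; apply/andP/eqP => [[L'aJ]|->].
    by rewrite in_joins // => /and3P[_ L'N _]; apply: Luniq.
  split=> //; move: LaJ; rewrite !in_joins // => /and3P[_ _ /eqP ->].
  by rewrite iN LN vN eqxx.
move=> L N; rewrite !in_joins // => /and3P[aL JL /eqP <-] /and3P[-> LN ->].
by rewrite (le_trans aL LN) (le_trans JL LN).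
Qed.

Section VertexMultiplication.
Variables (k : comNzRingType) (d : Order.disp_t) (S : finBPOrderType d).
Variables (n : nat) (lam : S -> 'I_n -> int) (g : S -> S -> 'I_n -> k).
Hypothesis S_simplicial : simplicial_poset S.
Hypothesis g_dual : forall K i j, i \in vertices K -> j \in vertices K ->
  weight lam (g K i) j = (i == j)%:R.
Local Notation F := (face_classes k S).
Variables (M : lmodType k) (pr : {linear F -> M}) (sec : M -> F).
Hypothesis pr_relation : forall m J,
  orthogonal_to lam J m -> pr (linear_relation lam m J) = 0.
Hypothesis pr_universal : forall f : {linear F -> M},
  (forall m J, orthogonal_to lam J m -> f (linear_relation lam m J) = 0) ->
  forall x, pr x = 0 -> f x = 0.
Hypothesis secK : cancel sec pr.
Implicit Types (a b i J K L : S) (m : 'I_n -> k).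

(* The product v_i v_J when [i] is not in [J]; otherwise the linear relation
   for the dual vector of [i] in [J] rewrites v_i v_J modulo Theta. *)
Definition vertex_mul i J : F :=
  if (i <= J)%O then - linear_relation lam (g J i) J else join_sum k i J.

(* Locked so that [linear_sum] does not unfold it. *)
Definition vertex_op i (x : F) : F := locked (\sum_J x J *: vertex_mul i J).

Lemma vertex_opE i x : vertex_op i x = \sum_J x J *: vertex_mul i J.
Proof. by rewrite /vertex_op -lock. Qed.

Lemma vertex_op_is_linear i : linear (vertex_op i).
Proof.
move=> c x y; rewrite !vertex_opE scaler_sumr -big_split /=.
by apply: eq_bigr => J _; rewrite !ffunE scalerA -scalerDl.
Qed.

HB.instance Definition _ i := GRing.isLinear.Build k F F _ (vertex_op i)
  (vertex_op_is_linear i).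

Lemma vertex_op_class i J : vertex_op i (face_class k J) = vertex_mul i J.
Proof.
rewrite vertex_opE (bigD1 J) //= ffunE eqxx scale1r big1 ?addr0 // => I IJ.
by rewrite ffunE (negPf IJ) scale0r.
Qed.

Lemma vertex_mul_notin i J : ~~ (i <= J)%O -> vertex_mul i J = join_sum k i J.
Proof. by rewrite /vertex_mul => /negPf ->. Qed.

Lemma vertex_mul_in i J :
  (i <= J)%O -> vertex_mul i J = - linear_relation lam (g J i) J.
Proof. by rewrite /vertex_mul => ->. Qed.

(** Subtracting from [m] its components along the dual vectors of [K] leaves a vector orthogonal to
    [K], whose relation vanishes. The subtracted terms are accounted for by the products with
    vertices of [K], by the definition of [vertex_mul]. *)
Lemma vertex_mul_relation m K :
  \sum_(a | vertex a) weight lam m a *: pr (vertex_mul a K) = 0.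
Proof.
pose m' j := m j - \sum_(i in vertices K) weight lam m i * g K i j.
have wE a : weight lam m' a = weight lam m a
    - \sum_(i in vertices K) weight lam m i * weight lam (g K i) a.
  rewrite /weight /m'; under eq_bigr do rewrite mulrBl mulr_suml.
  rewrite sumrB exchange_big; congr (_ - _); apply: eq_bigr => i _ /=.
  by rewrite mulr_sumr; apply: eq_bigr => j _; rewrite mulrA.
have m'K : orthogonal_to lam K m'.
  move=> j jK; rewrite wE (bigD1 j) //= g_dual // eqxx mulr1 big1 ?addr0 ?subrr //.
  by move=> i /andP[iK ij]; rewrite g_dual // (negPf ij) mulr0.
rewrite -[RHS](pr_relation m'K) (bigID (fun a => a <= K)%O) /= addrC.
rewrite /linear_relation linear_sum.
under [RHS]eq_bigr do rewrite linearZ /= wE scalerBl.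
rewrite sumrB; congr (_ + _).
  by apply: eq_bigr => a /andP[_ aK]; rewrite vertex_mul_notin.
under eq_bigr => i iK.
  rewrite (vertex_mul_in (andP iK).2) linearN /linear_relation linear_sum.
  rewrite scalerN scaler_sumr.
  under eq_bigr do rewrite linearZ scalerA /=.
  over.
rewrite sumrN exchange_big /=; congr (- _); apply: eq_bigr => a _.
rewrite scaler_suml; apply: eq_bigl => i.
by rewrite in_vertices.
Qed.

Lemma vertex_op_join i a J :
  vertex_op i (join_sum k a J) = \sum_(L in joins a J) vertex_mul i L.
Proof.
by rewrite linear_sum; apply: eq_bigr => L _; exact: vertex_op_class.
Qed.

Lemma vertex_op_joinC i a J : vertex i -> vertex a ->
  ~~ (i <= J)%O -> ~~ (a <= J)%O ->
  vertex_op i (join_sum k a J) = vertex_op a (join_sum k i J).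
Proof.
have [-> //|ia] := eqVneq i a.
have opE b c : vertex b -> vertex c -> b != c -> ~~ (b <= J)%O -> ~~ (c <= J)%O ->
    vertex_op b (join_sum k c J) =
    \sum_(L in joins c J) \sum_(N in joins b L) face_class k N.
  move=> vb vc bc bJ cJ; rewrite vertex_op_join; apply: eq_bigr => L.
  rewrite in_joins // => /and3P[_ _ /eqP vL]; rewrite vertex_mul_notin //.
  have : b \notin vertices L.
    by rewrite vL inE (vertices_vertex vc) !inE (negPf bc) vb.
  by rewrite in_vertices vb.
move=> vi va iJ aJ; rewrite !opE // 1?eq_sym // !joins_joins_sum //.
by apply: eq_bigl => N; rewrite andbCA finset.setUCA.
Qed.

(** If [i] is in [J], the vector [g J i] can be used on every [L] above [J], in place of [g L i]: it
    expresses the action of [i] through vertices outside [J]. The case of two vertices outside [J]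
    then applies term by term. *)
Lemma vertex_op_commute i a J : vertex i -> vertex a -> ~~ (a <= J)%O ->
  pr (vertex_op i (vertex_mul a J)) = pr (vertex_op a (vertex_mul i J)).
Proof.
move=> vi va aJ; rewrite (vertex_mul_notin aJ).
have [iJ|iJ] := boolP (i <= J)%O; last first.
  by rewrite vertex_mul_notin // vertex_op_joinC.
have iv : i \in vertices J by rewrite in_vertices vi.
have mulE L : (J <= L)%O -> pr (vertex_mul i L) =
    - \sum_(b | vertex b && ~~ (b <= J)%O)
        weight lam (g J i) b *: pr (vertex_mul b L).
  move=> JL; have := vertex_mul_relation (g J i) L.
  rewrite (bigID (fun b => b <= J)%O) /= (bigD1 i) /= ?vi // g_dual // eqxx.
  rewrite scale1r big1 ?addr0 => [/eqP|b /andP[/andP[vb bJ] bi]].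
    by rewrite addr_eq0 => /eqP.
  by rewrite g_dual // ?in_vertices ?vb // eq_sym (negPf bi) scale0r.
rewrite vertex_op_join linear_sum.
under eq_bigr => L.
  rewrite in_joins // => /and3P[_ JL _]; rewrite (mulE L JL); over.
rewrite (vertex_mul_in iJ) linearN linearN /= sumrN; congr (- _).
rewrite exchange_big /linear_relation linear_sum linear_sum /=.
apply: eq_bigr => b /andP[vb bJ].
rewrite -scaler_sumr -linear_sum -vertex_op_join vertex_op_joinC //.
by rewrite linearZ /= linearZ.
Qed.

(** Commuting turns the image into sum_a <m, lambda_a> v_a (v_i [X_J]), which vanishes by
    [vertex_mul_relation] on each class occurring in v_i [X_J]. *)
Lemma vertex_op_relation i m J : vertex i -> orthogonal_to lam J m ->
  pr (vertex_op i (linear_relation lam m J)) = 0.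
Proof.
move=> vi mJ; rewrite /linear_relation !linear_sum /=.
transitivity (\sum_(a | vertex a) weight lam m a *: pr (vertex_op a (vertex_mul i J))).
  rewrite [RHS](bigID (fun a => a <= J)%O) /= [X in X + _]big1 ?add0r.
    apply: eq_bigr => a /andP[va aJ].
    by rewrite !linearZ /= -vertex_op_commute // vertex_mul_notin.
  by move=> a /andP[va aJ]; rewrite mJ ?scale0r // in_vertices va.
under eq_bigr do rewrite vertex_opE linear_sum scaler_sumr.
rewrite exchange_big big1 //= => K _.
under eq_bigr do rewrite linearZ /= scalerA mulrC -scalerA.
by rewrite -scaler_sumr vertex_mul_relation scaler0.
Qed.

Definition quotient_op i (y : M) : M := pr (vertex_op i (sec y)).

(** The composite of [vertex_op] with [pr] kills the relations, hence by [pr_universal] the kernel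
    of [pr]; so the choice of the section [sec] does not matter. *)
Lemma quotient_op_pr i x : vertex i ->
  quotient_op i (pr x) = pr (vertex_op i x).
Proof.
move=> vi; apply/eqP; rewrite -subr_eq0 -linearB -linearB /=.
apply/eqP; apply: (pr_universal (f := pr \o vertex_op i)) => [m J mJ|].
  exact: vertex_op_relation.
by rewrite linearB /= secK subrr.
Qed.

Lemma quotient_op_is_linear i : vertex i -> linear (quotient_op i).
Proof.
move=> vi c x y; rewrite -[x]secK -[y]secK -linearZ -linearD /=.
by rewrite !quotient_op_pr // !linearD !linearZ.
Qed.

(** The case left is that both vertices lie in [J]. Their dual vectors replace both by vertices
    outside [J], and the resulting double sum is symmetric by [vertex_op_joinC]. *)
Lemma quotient_opC i a y : vertex i -> vertex a ->
  quotient_op i (quotient_op a y) = quotient_op a (quotient_op i y).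
Proof.
move=> vi va; rewrite -[y]secK [sec y]face_classes_sum !quotient_op_pr // !linear_sum.
apply: eq_bigr => J _ /=; rewrite !linearZ /= !vertex_op_class; congr (_ *: _).
have [aJ|] := boolP (a <= J)%O; last exact: vertex_op_commute.
have [iJ|] := boolP (i <= J)%O; last first.
  by move=> iJ; apply/esym/vertex_op_commute.
have opE b c : vertex b -> vertex c -> (b <= J)%O -> (c <= J)%O ->
    pr (vertex_op b (vertex_mul c J)) =
    \sum_(e | vertex e && ~~ (e <= J)%O) \sum_(h | vertex h && ~~ (h <= J)%O)
      (weight lam (g J c) e * weight lam (g J b) h) *: pr (vertex_op e (join_sum k h J)).
  move=> vb vc bJ cJ; rewrite (vertex_mul_in cJ) linearN linearN /=.
  rewrite /linear_relation (linear_sum (vertex_op b)) (linear_sum pr) -sumrN.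
  apply: eq_bigr => e /andP[ve eJ]; rewrite linearZ linearZ /= -vertex_mul_notin //.
  rewrite vertex_op_commute // (vertex_mul_in bJ) linearN linearN /=.
  rewrite /linear_relation (linear_sum (vertex_op e)) (linear_sum pr) /=.
  rewrite scalerN opprK scaler_sumr; apply: eq_bigr => h _.
  by rewrite linearZ linearZ /= scalerA.
rewrite !opE // exchange_big /=; apply: eq_bigr => e /andP[ve eJ].
apply: eq_bigr => h /andP[vh hJ]; rewrite mulrC.
by rewrite vertex_op_joinC.
Qed.

Lemma quotient_op_theta m y : \sum_(a | vertex a) weight lam m a *: quotient_op a y = 0.
Proof.
rewrite -[y]secK [sec y]face_classes_sum.
under eq_bigr => a va do rewrite quotient_op_pr // vertex_opE linear_sum scaler_sumr.
rewrite exchange_big big1 //= => K _.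
under eq_bigr do rewrite linearZ /= scalerA mulrC -scalerA.
by rewrite -scaler_sumr vertex_mul_relation scaler0.
Qed.

End VertexMultiplication.

(** * Values of face ring monomials in the quotient *)

Section MonomialAction.
Variables (d : Order.disp_t) (S : finBPOrderType d).
Hypothesis S_simplicial : simplicial_poset S.
Variables (M : zmodType) (X : S -> M -> M) (c : S -> M).
Hypothesis X_add : forall i, vertex i -> {morph X i : x y / x + y}.
Hypothesis X_comm : forall i j y, vertex i -> vertex j -> X i (X j y) = X j (X i y).
Hypothesis X_class : forall i K, vertex i -> ~~ (i <= K)%O ->
  X i (c K) = \sum_(L in joins i K) c L.
Implicit Types (i j I J K L : S) (h : S -> nat).

Definition power_action h (y : M) : M :=
  foldr (fun i => iter (h i) (X i)) y (enum [set i : S | vertex i]%SET).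

Lemma power_action_ext h h' y : (forall i, vertex i -> h i = h' i) ->
  power_action h y = power_action h' y.
Proof.
move=> hh; rewrite /power_action.
have : {in enum [set i : S | vertex i]%SET, h =1 h'}.
  by move=> i; rewrite mem_enum inE; exact: hh.
elim: (enum _) => //= i s IHs hs; rewrite hs ?mem_head // IHs // => j js.
by apply: hs; rewrite inE js orbT.
Qed.

Lemma power_action0 y : power_action (fun=> 0%N) y = y.
Proof. by rewrite /power_action; elim: (enum _). Qed.

Lemma iter_X_comm i j m y : vertex i -> vertex j ->
  iter m (X j) (X i y) = X i (iter m (X j) y).
Proof. by move=> vi vj; elim: m => //= m ->; rewrite X_comm. Qed.

Lemma power_action_X h i y : vertex i ->
  power_action h (X i y) = X i (power_action h y).
Proof.
move=> vi; rewrite /power_action.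
have : {in enum [set i : S | vertex i]%SET, forall j, vertex j}.
  by move=> j; rewrite mem_enum inE.
elim: (enum _) => //= j s IHs hs; rewrite IHs; last first.
  by move=> l ls; apply: hs; rewrite inE ls orbT.
by rewrite iter_X_comm // hs ?mem_head.
Qed.

Lemma power_action_succ h i y : vertex i ->
  power_action (fun j => h j + (j == i))%N y = X i (power_action h y).
Proof.
move=> vi; rewrite /power_action; move: (enum_uniq [set i : S | vertex i]%SET).
have : i \in enum [set i : S | vertex i]%SET by rewrite mem_enum inE.
have : {in enum [set i : S | vertex i]%SET, forall j, vertex j}.
  by move=> j; rewrite mem_enum inE.
elim: (enum _) => //= j s IHs hs + /andP[js us].
have vj : vertex j by apply: hs; rewrite mem_head.
have vs : {in s, forall j, vertex j}.
  by move=> l ls; apply: hs; rewrite inE ls orbT.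
rewrite inE => /orP[/eqP ij|iS]; last first.
  have -> : (j == i) = false by apply: contraNF js => /eqP ->.
  by rewrite addn0 IHs // iter_X_comm.
subst j; rewrite eqxx addn1 iterS; congr (X i (iter _ _ _)).
elim: s js {IHs hs us vs} => //= j s IHs; rewrite inE negb_or => /andP[ij js].
by rewrite IHs // eq_sym (negPf ij) addn0.
Qed.

Lemma iter_X_add i m : vertex i -> {morph iter m (X i) : x y / x + y}.
Proof. by move=> vi x y; elim: m => //= m ->; rewrite X_add. Qed.

Lemma power_action_add h : {morph power_action h : x y / x + y}.
Proof.
move=> x y; rewrite /power_action.
have : {in enum [set i : S | vertex i]%SET, forall j, vertex j}.
  by move=> j; rewrite mem_enum inE.
elim: (enum _) => //= j s IHs hs; rewrite IHs; last first.
  by move=> l ls; apply: hs; rewrite inE ls orbT.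
by rewrite iter_X_add // hs ?mem_head.
Qed.

Lemma additive_sum (f : M -> M) (T : finType) (P : pred T) (F : T -> M) :
  {morph f : x y / x + y} -> f (\sum_(t | P t) F t) = \sum_(t | P t) f (F t).
Proof.
move=> fD; apply: (big_morph f fD); apply: (addIr (f 0)).
by rewrite -fD !add0r.
Qed.

(* Here [h] is the exponent of a monomial in the variables v_I.  Restricted to
   a simplex whose faces include all [I] with [h I != 0], v_I becomes the
   product of the vertices of [I], and [degree_at h i] is the exponent of [i]. *)
Definition degree_at h i := (\sum_(I | (i <= I)%O) h I)%N.

(** The restriction of the monomial to [K] is nonzero and involves every vertex of [K]. *)
Definition carries h K :=
  [forall I, (h I != 0%N) ==> (I <= K)%O] &&
  (vertices K == [set i | vertex i & degree_at h i != 0%N]%SET).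

(* The monomial is the sum of the monomials x^a that it restricts to on the
   carrying simplices [K], and x^a = x^(a - 1_K) v_K. *)
Definition monomial_value h : M :=
  \sum_(K | carries h K) power_action (fun i => degree_at h i - (i <= K)%O)%N (c K).

Definition times_var h I : S -> nat := fun J => (h J + (J == I))%N.

Lemma degree_at_times_var h I i :
  degree_at (times_var h I) i = (degree_at h i + (i <= I)%O)%N.
Proof.
rewrite /degree_at big_split /=; congr (_ + _)%N.
have [iI|iI] := boolP (i <= I)%O.
  rewrite (bigD1 I) //= eqxx big1 ?addn0 // => J /andP[_ /negPf ->] //.
by rewrite big1 // => J iJ; case: eqP => // JI; rewrite -JI iJ in iI.
Qed.

Lemma support_times_var h I K :
  [forall J, (times_var h I J != 0%N) ==> (J <= K)%O] =
  (I <= K)%O && [forall J, (h J != 0%N) ==> (J <= K)%O].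
Proof.
apply/forallP/andP => [hK|[IK /forallP hK] J].
  split; first by have := hK I; rewrite /times_var eqxx addn1.
  apply/forallP => J; apply/implyP => hJ; apply: (implyP (hK J)).
  by rewrite /times_var addn_eq0 negb_and hJ.
rewrite /times_var; have [->|_] := eqVneq J I; first by rewrite IK implybT.
by rewrite addn0.
Qed.

Lemma carries_congr h h' K :
  [forall J, (h J != 0%N) ==> (J <= K)%O] = [forall J, (h' J != 0%N) ==> (J <= K)%O] ->
  (forall i, vertex i -> degree_at h i = degree_at h' i) ->
  carries h K = carries h' K.
Proof.
move=> hh dd; rewrite /carries hh; congr (_ && (_ == _)).
by apply/setP => i; rewrite !inE; case: (boolP (vertex i)) => //= /dd ->.
Qed.

Lemma monomial_value_congr h h' :
  (forall K, [forall J, (h J != 0%N) ==> (J <= K)%O] =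
             [forall J, (h' J != 0%N) ==> (J <= K)%O]) ->
  (forall i, vertex i -> degree_at h i = degree_at h' i) ->
  monomial_value h = monomial_value h'.
Proof.
move=> hh dd; apply: eq_big => [K|K _]; first exact: carries_congr.
by apply: power_action_ext => i /dd ->.
Qed.

Lemma monomial_value_bot h : monomial_value (times_var h \bot%O) = monomial_value h.
Proof.
apply: monomial_value_congr => [K|i /andP[i0 _]].
  by rewrite support_times_var le0x.
by rewrite degree_at_times_var lex0 (negPf i0) addn0.
Qed.

Lemma monomial_value_no_join h I J : joins I J = finset.set0 ->
  monomial_value (times_var (times_var h I) J) = 0.
Proof.
move=> IJ; apply: big1 => K /andP[]; rewrite !support_times_var.
move=> /and3P[JK IK _] _.
have [L] := joins_sub_unique S_simplicial IK JK.
by rewrite IJ inE.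
Qed.

(** A simplex carrying the left monomial lies above exactly one join [L]. There v_N v_L and v_I v_J
    restrict to the same monomial, since intersection and union together count each vertex as often
    as [I] and [J] do. *)
Lemma monomial_value_join h I J N : is_meet I J N -> joins I J != finset.set0 ->
  monomial_value (times_var (times_var h I) J) =
  \sum_(L in joins I J) monomial_value (times_var (times_var h N) L).
Proof.
move=> meetN /set0Pn[L0 L0IJ]; set h' := times_var _ J.
pose h2 L := times_var (times_var h N) L.
have degE L i : L \in joins I J -> vertex i -> degree_at (h2 L) i = degree_at h' i.
  rewrite in_joins // => /and3P[IL JL /eqP vL] vi.
  rewrite /h2 /h' !degree_at_times_var -!addnA; congr addn.
  have -> : (i <= N)%O = (i <= I)%O && (i <= J)%O.
    have := vertices_meet S_simplicial IL JL meetN => /setP/(_ i).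
    by rewrite finset.in_setI !in_vertices vi.
  have -> : (i <= L)%O = (i <= I)%O || (i <= J)%O.
    by move/setP: vL => /(_ i); rewrite finset.in_setU !in_vertices vi.
  by case: (i <= I)%O; case: (i <= J)%O.
have carE L K : L \in joins I J -> carries (h2 L) K = carries h' K && (L <= K)%O.
  move=> LIJ; have := LIJ; rewrite in_joins // => /and3P[IL JL _].
  have [LK|LK] := boolP (L <= K)%O.
    rewrite andbT; apply: carries_congr; last by move=> i; exact: degE.
    rewrite !support_times_var LK (le_trans IL LK) (le_trans JL LK).
    by have [NI _ _] := meetN; rewrite (le_trans NI (le_trans IL LK)).
  by rewrite andbF /carries support_times_var (negPf LK).
rewrite /monomial_value -/h'.
rewrite [RHS](exchange_big_dep (carries h')) /=; last first.
  by move=> L K LIJ; rewrite -/(h2 L) carE // => /andP[].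
apply: eq_bigr => K hK.
have /andP[IK JK] : (I <= K)%O && (J <= K)%O.
  by case/andP: hK; rewrite /h' !support_times_var => /and3P[-> ->].
have [L LIJ [LK Luniq]] := joins_sub_unique S_simplicial IK JK.
rewrite (big_pred1 L) => [|L' /=].
  by apply: power_action_ext => i vi; rewrite -/(h2 L) degE.
rewrite -/(h2 L'); apply/andP/eqP => [[L'IJ]|->].
  by rewrite carE // => /andP[_ L'K]; apply: Luniq.
by rewrite carE // hK LK.
Qed.

(** If [i] already occurs in the monomial, the carriers stay the same and one exponent grows by one.
    Otherwise no carrier contains [i], the operator sends each class to its joins with [i], and
    every new carrier [L] comes from exactly one old carrier, its face on [V]. *)
Lemma monomial_value_vertex h i : vertex i ->
  monomial_value (times_var h i) = X i (monomial_value h).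
Proof.
move=> vi; rewrite /monomial_value (additive_sum _ _ (X_add vi)).
pose V := [set j | vertex j & degree_at h j != 0%N]%SET.
have degE j : vertex j -> degree_at (times_var h i) j = (degree_at h j + (j == i))%N.
  by move=> vj; rewrite degree_at_times_var vertex_le.
have VE : [set j | vertex j & degree_at (times_var h i) j != 0%N]%SET = (i |: V)%SET.
  apply/setP => j; rewrite !inE; have [vj|nvj] := boolP (vertex j).
    by rewrite degE // addn_eq0 negb_and orbC; case: (j == i).
  by have [ji|//] := eqVneq j i; rewrite ji vi in nvj.
have [hi|hi] := eqVneq (degree_at h i) 0%N; last first.
  have iV : i \in V by rewrite inE vi hi.
  apply: eq_big => [K|K].
    have -> : carries (times_var h i) K =
        (i <= K)%O && carries h K.
      rewrite /carries VE support_times_var -andbA.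
      by rewrite (finset.setUidPr _) ?finset.sub1set.
    rewrite /carries -/V; case: (vertices K =P V) => [vK|]; last by rewrite !andbF.
    by have : i \in vertices K; [rewrite vK | rewrite in_vertices => /andP[_ ->]].
  rewrite /carries VE => /andP[_ /eqP vK].
  have iK : (i <= K)%O.
    have : i \in vertices K by rewrite vK inE inE eqxx.
    by rewrite in_vertices => /andP[].
  rewrite -power_action_succ //; apply: power_action_ext => j vj; rewrite degE //.
  have [->|_] := eqVneq j i; last by rewrite !addn0.
  by rewrite iK addnK subnK // lt0n.
have iV : i \notin V by rewrite inE hi vi.
have iNK K : carries h K -> ~~ (i <= K)%O.
  move=> /andP[_ /eqP vK]; have : i \notin vertices K by rewrite vK.
  by rewrite in_vertices vi.
rewrite [RHS](eq_bigr (fun K => \sum_(L in joins i K)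
    power_action (fun j => degree_at h j - (j <= K)%O)%N (c L))); last first.
  move=> K hK; rewrite -power_action_X // X_class ?iNK //.
  by rewrite (additive_sum _ _ (power_action_add _)).
rewrite [RHS](exchange_big_dep (carries (times_var h i))) /=; last first.
  move=> K L /andP[/forallP hK /eqP vK]; rewrite in_joins // => /and3P[iL KL /eqP vL].
  rewrite /carries VE support_times_var iL vL vK (vertices_vertex vi) eqxx andbT /=.
  by apply/forallP => J; apply/implyP => /(implyP (hK J)) JK; apply: le_trans KL.
apply: eq_bigr => L /andP[]; rewrite support_times_var VE.
move=> /andP[iL /forallP hL] /eqP vL.
have [|K KL vK] := @face_of_vertices _ _ S_simplicial L V.
  by rewrite vL finset.subsetUr.
rewrite (big_pred1 K) => [|K' /=].
  apply: power_action_ext => j vj; rewrite degE //.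
  have -> : (j <= L)%O = (j == i) || (j <= K)%O.
    have : (j \in vertices L) = (j \in i |: vertices K)%SET by rewrite vL vK.
    by rewrite !inE vj.
  have [->|_] := eqVneq j i; last by rewrite addn0.
  by rewrite hi.
apply/andP/eqP => [[/andP[_ /eqP vK']]|->].
  rewrite in_joins // => /and3P[_ K'L _].
  by apply: (vertices_inj S_simplicial K'L KL); rewrite vK' vK.
rewrite in_joins // iL KL vL vK (vertices_vertex vi) eqxx.
rewrite /carries vK eqxx andbT; split=> //.
apply/forallP => J; apply/implyP => hJ.
rewrite (le_vertices S_simplicial (implyP (hL J) hJ) KL) vK.
apply/fintype.subsetP => j; rewrite in_vertices inE => /andP[vj jJ].
by rewrite vj /degree_at (bigD1 J) //= addn_eq0 negb_and hJ.
Qed.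

Lemma monomial_value_var I : monomial_value (times_var (fun=> 0%N) I) = c I.
Proof.
have deg0 i : degree_at (fun=> 0%N) i = 0%N by rewrite /degree_at big1.
rewrite /monomial_value (big_pred1 I) => [|K /=].
  rewrite -[RHS]power_action0; apply: power_action_ext => i vi.
  by rewrite degree_at_times_var deg0 add0n subnn.
rewrite /carries support_times_var.
have -> : [set i | vertex i & degree_at (times_var (fun=> 0%N) I) i != 0%N]%SET
    = vertices I.
  by apply/setP => i; rewrite !inE degree_at_times_var deg0; case: (i <= I)%O.
apply/andP/eqP => [[/andP[IK _] /eqP vK]|->].
  exact: (vertices_inj S_simplicial (lexx K) IK).
by rewrite lexx eqxx; split=> //; apply/forallP.
Qed.

End MonomialAction.

(** * The linear map from the face ring to the quotient *)

Section FaceRingAction.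
Variables (k : comNzRingType) (d : Order.disp_t) (S : finBPOrderType d).
Hypothesis S_simplicial : simplicial_poset S.
Variables (M : lmodType k) (X : S -> M -> M) (c : S -> M).
Hypothesis X_linear : forall i, vertex i -> linear (X i).
Hypothesis X_comm : forall i j y, vertex i -> vertex j -> X i (X j y) = X j (X i y).
Hypothesis X_class : forall i K, vertex i -> ~~ (i <= K)%O ->
  X i (c K) = \sum_(L in joins i K) c L.
Implicit Types (i I J K L : S) (p q : poly_ring k S).
Local Notation multinom := (mpoly.multinom #|S|).
Local Notation "''X_[' m ]" := (mpoly.mpolyX k m : poly_ring k S).
Local Notation var := (poly_var k).

Lemma X_additive i : vertex i -> {morph X i : x y / x + y}.
Proof. by move=> vi x y; have := X_linear vi 1 x y; rewrite !scale1r. Qed.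

Definition exponent (m : multinom) : S -> nat :=
  fun I => mpoly.fun_of_multinom m (enum_rank I).

Definition poly_value p : M :=
  \sum_(m <- mpoly.msupp p) mpoly.mcoeff m p *: monomial_value X c (exponent m).

Lemma poly_value_widen p (s : seq multinom) : uniq s ->
  {subset mpoly.msupp p <= s} ->
  poly_value p = \sum_(m <- s) mpoly.mcoeff m p *: monomial_value X c (exponent m).
Proof.
move=> us ps; rewrite /poly_value (perm_big [seq m <- s | m \in mpoly.msupp p]).
  rewrite big_filter [RHS](bigID (fun m => m \in mpoly.msupp p)) /=.
  by rewrite [X in _ + X]big1 ?addr0 // => m /mpoly.memN_msupp_eq0 ->; rewrite scale0r.
apply: uniq_perm; rewrite ?mpoly.msupp_uniq ?filter_uniq // => m.
by rewrite mem_filter; case mp : (_ \in _) => //=; rewrite ps.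
Qed.

Lemma poly_value_is_linear : linear poly_value.
Proof.
move=> a p q.
pose s := undup (mpoly.msupp (a *: p + q) ++ mpoly.msupp p ++ mpoly.msupp q).
have us : uniq s by exact: undup_uniq.
have sub r : r \in [:: a *: p + q; p; q] -> {subset mpoly.msupp r <= s}.
  rewrite !inE => /or3P[] /eqP -> m mr; by rewrite mem_undup !mem_cat mr ?orbT.
rewrite !(poly_value_widen us (sub _ _)) ?inE ?eqxx ?orbT //.
rewrite scaler_sumr -big_split /=; apply: eq_bigr => m _.
by rewrite mpoly.mcoeffD mpoly.mcoeffZ scalerDl scalerA.
Qed.

HB.instance Definition _ := GRing.isLinear.Build k (poly_ring k S) M _ poly_value
  poly_value_is_linear.

Lemma poly_value_monomial m : poly_value 'X_[m] = monomial_value X c (exponent m).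
Proof.
by rewrite /poly_value mpoly.msuppX big_seq1 mpoly.mcoeffX eqxx scale1r.
Qed.

Lemma monomial_value_ext h h' : h =1 h' ->
  monomial_value X c h = monomial_value X c h'.
Proof. by move=> hh; congr monomial_value; apply/funext. Qed.

Lemma exponent_mnm_add m I :
  exponent (mpoly.mnm_add m (mpoly.mnm1 (enum_rank I))) = times_var (exponent m) I.
Proof.
apply/funext => J; rewrite /exponent mpoly.mnmDE mpoly.mnm1E /times_var.
by rewrite (inj_eq enum_rank_inj) eq_sym.
Qed.

Lemma monomial_times_var m I :
  'X_[m] * var I = 'X_[mpoly.mnm_add m (mpoly.mnm1 (enum_rank I))].
Proof. by rewrite /poly_var mpoly.mpolyXD. Qed.

Lemma poly_sum p :
  p = \sum_(m <- mpoly.msupp p) mpoly.mcoeff m p *: 'X_[m].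
Proof. exact: mpoly.mpolyE. Qed.

Lemma poly_value_relation p r : face_relation r -> poly_value (p * r) = 0.
Proof.
move=> rel; rewrite (poly_sum p) mulr_suml linear_sum big1 // => m _.
rewrite -scalerAl linearZ /= (_ : poly_value _ = 0) ?scaler0 // => {p}.
case: rel => [->|[I [J [N [IJ meetN ->]]]]|[I [J [IJ ->]]]].
- rewrite mulrBr mulr1 linearB /= monomial_times_var !poly_value_monomial.
  by rewrite exponent_mnm_add monomial_value_bot subrr.
- rewrite mulrBr linearB /= !mulrA; apply/eqP; rewrite subr_eq0; apply/eqP.
  rewrite mulr_sumr linear_sum /= !monomial_times_var poly_value_monomial.
  rewrite !exponent_mnm_add.
  rewrite (monomial_value_join S_simplicial X c _ meetN (introN eqP IJ)).
  apply: eq_bigr => L _; rewrite monomial_times_var poly_value_monomial.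
  by rewrite !exponent_mnm_add.
- rewrite mulrA !monomial_times_var poly_value_monomial !exponent_mnm_add.
  exact: monomial_value_no_join.
Qed.

Lemma poly_value_face_ideal p : p \in @face_ideal k d S -> poly_value p = 0.
Proof.
move=> /asboolP[s [sG ->]]; rewrite linear_sum big_seq big1 // => q /sG.
exact: poly_value_relation.
Qed.

Lemma poly_value_vertex i p : vertex i ->
  poly_value (p * var i) = X i (poly_value p).
Proof.
move=> vi.
elim/mpoly.mpolyind: p => [|a m p _ _ IH].
  rewrite mul0r linear0; have := X_linear vi (-1) 0 0.
  by rewrite scaler0 addr0 scaleN1r addNr.
rewrite mulrDl -scalerAl !linearP /= IH (X_linear vi); congr (_ *: _ + _).
rewrite monomial_times_var !poly_value_monomial exponent_mnm_add.
exact: (monomial_value_vertex S_simplicial X_additive X_comm X_class).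
Qed.

Lemma poly_value_var I : poly_value (var I) = c I.
Proof.
rewrite -[var I]mul1r -(mpoly.mpolyX0 _ k) monomial_times_var poly_value_monomial.
rewrite exponent_mnm_add -[RHS](monomial_value_var S_simplicial X).
apply: monomial_value_ext => J; rewrite /times_var; congr (_ + _)%N.
by rewrite /exponent mpoly.mnm0E.
Qed.

Definition face_ring_value (x : face_ring k S) : M := poly_value (repr x).

Lemma face_ring_value_proj p : face_ring_value (face_ring_proj p) = poly_value p.
Proof.
apply/eqP; rewrite -subr_eq0 -linearB /=; apply/eqP/poly_value_face_ideal.
by rewrite Quotient.idealrBE; apply/eqP; exact: reprK.
Qed.

Lemma face_ring_value_is_linear : linear face_ring_value.
Proof.
move=> a x y; have [p <-] := face_ring_projK x; have [q <-] := face_ring_projK y.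
rewrite -face_ring_projZ -(raddfD (\pi_(face_ring k S))) !face_ring_value_proj.
exact: linearP.
Qed.

HB.instance Definition _ := GRing.isLinear.Build k (face_ring k S) M _
  face_ring_value face_ring_value_is_linear.

Lemma face_ring_value_var I : face_ring_value (face_var k I) = c I.
Proof. by rewrite face_ring_value_proj poly_value_var. Qed.

Lemma face_ring_value_vertex i x : vertex i ->
  face_ring_value (x * face_var k i) = X i (face_ring_value x).
Proof.
move=> vi; have [p <-] := face_ring_projK x.
by rewrite -face_ring_projM !face_ring_value_proj poly_value_vertex.
Qed.

Variables (n : nat) (lam : S -> 'I_n -> int).
Hypothesis X_theta : forall j y, \sum_(a | vertex a) (lam a j)%:~R *: X a y = 0.

Lemma face_ring_value_Theta x : x \in ideal_span (Theta k lam) ->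
  face_ring_value x = 0.
Proof.
move=> /asboolP[s [sG ->]]; rewrite linear_sum big_seq big1 // => q /sG [j _ <-].
rewrite /theta mulr_sumr linear_sum -[RHS](X_theta j (face_ring_value q.1)).
by apply: eq_bigr => i vi; rewrite -scalerAr linearZ /= face_ring_value_vertex.
Qed.

Lemma face_ring_value_phi x : face_ring_value (phi k x) = \sum_I (x I : k) *: c I.
Proof.
rewrite /phi linear_sum; apply: eq_bigr => I _.
by rewrite linearZ /= face_ring_value_var.
Qed.

End FaceRingAction.

(** * The face ring modulo Theta is spanned by the v_I *)

Section FaceRingQuotient.
Variables (k : comNzRingType) (d : Order.disp_t) (S : finBPOrderType d).
Variables (n : nat) (lam : S -> 'I_n -> int).
Hypothesis S_simplicial : simplicial_poset S.
Implicit Types (a i I J K L N : S) (m : 'I_n -> k) (x y z : face_ring k S).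
Local Notation v := (face_var k).
Local Notation Theta_ideal := (ideal_span (Theta k lam)).

Lemma face_ring_proj0 p : face_relation p -> face_ring_proj p = 0 :> face_ring k S.
Proof.
move=> rel; apply/eqP; rewrite -[0](raddf0 (\pi_(face_ring k S))).
rewrite -Quotient.idealrBE subr0; apply/asboolP; exists [:: (1, p)].
by split; [move=> q; rewrite inE => /eqP -> | rewrite big_seq1 mul1r].
Qed.

Lemma face_ring_projB : {morph @face_ring_proj k d S : p q / p - q}.
Proof. exact: (raddfB (\pi_(face_ring k S))). Qed.

Lemma face_ring_proj_sum (T : finType) (P : pred T) (f : T -> poly_ring k S) :
  face_ring_proj (\sum_(t | P t) f t) = \sum_(t | P t) face_ring_proj (f t).
Proof. exact: (raddf_sum (\pi_(face_ring k S))). Qed.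

Lemma face_var_bot : v (\bot%O : S) = 1.
Proof.
have : face_relation (poly_var k (\bot%O : S) - 1) by apply: Or31.
move/face_ring_proj0; rewrite face_ring_projB => /eqP; rewrite subr_eq0 => /eqP.
by rewrite /face_var => ->; exact: (rmorph1 (\pi_(face_ring k S))).
Qed.

Lemma face_var_mul I J N : joins I J != finset.set0 -> is_meet I J N ->
  v I * v J = v N * \sum_(L in joins I J) v L.
Proof.
move=> /eqP IJ meetN.
have : face_relation (poly_var k I * poly_var k J
    - poly_var k N * \sum_(L in joins I J) poly_var k L).
  by apply: Or32; exists I, J, N.
move/face_ring_proj0; rewrite face_ring_projB !face_ring_projM face_ring_proj_sum.
by move=> /eqP; rewrite subr_eq0 => /eqP.
Qed.

Lemma face_var_mul0 I J : joins I J = finset.set0 -> v I * v J = 0.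
Proof.
move=> IJ; rewrite -face_ring_projM; apply: face_ring_proj0.
by apply: Or33; exists I, J.
Qed.

Lemma phi_join_sum i J : phi k (join_sum k i J) = \sum_(L in joins i J) v L.
Proof. by rewrite linear_sum; apply: eq_bigr => L _; exact: phi_face_class. Qed.

Lemma face_var_vertex_mul i J : vertex i -> ~~ (i <= J)%O ->
  v i * v J = phi k (join_sum k i J).
Proof.
move=> vi iJ; rewrite phi_join_sum.
have [e|ne] := eqVneq (joins i J) finset.set0.
  by rewrite face_var_mul0 // e big_set0.
rewrite (@face_var_mul i J \bot%O) // ?face_var_bot ?mul1r //.
split; rewrite ?le0x // => L Li LJ; have [Le|Lni] := eqVneq L i.
  by rewrite -Le LJ in iJ.
move: vi => /andP[_ /forallP/(_ L)]; rewrite lt_neqAle Lni Li /= => /eqP ->.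
exact: le0x.
Qed.

Lemma Theta_ideal_mul x y : x \in Theta_ideal -> y * x \in Theta_ideal.
Proof.
by move=> xT; rewrite -[_ * _]addr0; apply: ideal_spanP => //; exact: ideal_span0.
Qed.

Lemma weighted_vertices_Theta m :
  \sum_(a : S | vertex a) weight lam m a *: v a \in Theta_ideal.
Proof.
rewrite (_ : \sum_(a | _) _ = \sum_j m j *: theta k lam j).
  apply: rpred_sum => j _; apply: rpredZ; apply/asboolP.
  exists [:: (1, theta k lam j)]; split; last by rewrite big_seq1 mul1r.
  by move=> p; rewrite inE => /eqP ->; exists j.
under [RHS]eq_bigr do rewrite scaler_sumr.
rewrite exchange_big; apply: eq_bigr => a _.
by rewrite scaler_suml; apply: eq_bigr => j _; rewrite scalerA.
Qed.

Lemma phi_linear_relationE m J :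
  phi k (linear_relation lam m J) =
  \sum_(a | vertex a && ~~ (a <= J)%O) weight lam m a *: (v a * v J).
Proof.
rewrite linear_sum; apply: eq_bigr => a /andP[va aJ].
by rewrite linearZ /= face_var_vertex_mul.
Qed.

Lemma weighted_products_Theta m J :
  \sum_(a : S | vertex a) weight lam m a *: (v a * v J) \in Theta_ideal.
Proof.
under eq_bigr do rewrite scalerAl.
by rewrite -mulr_suml mulrC; apply/Theta_ideal_mul/weighted_vertices_Theta.
Qed.

Lemma phi_linear_relation m J : orthogonal_to lam J m ->
  phi k (linear_relation lam m J) \in Theta_ideal.
Proof.
move=> mJ; rewrite phi_linear_relationE.
have := weighted_products_Theta m J; rewrite (bigID (fun a => a <= J)%O) /=.
rewrite big1 ?add0r // => a /andP[va aJ].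
by rewrite mJ ?scale0r // in_vertices va.
Qed.

Variable g : S -> S -> 'I_n -> k.
Hypothesis g_dual : forall K i j, i \in vertices K -> j \in vertices K ->
  weight lam (g K i) j = (i == j)%:R.

(** For [i] in [J], the vector [g J i] has weight 1 at [i] and 0 at the other vertices of [J], so
    the corresponding combination of Theta times v_J rewrites v_i v_J as [vertex_mul] prescribes. *)
Lemma phi_vertex_mul i J : vertex i ->
  v i * v J - phi k (vertex_mul lam g i J) \in Theta_ideal.
Proof.
move=> vi; rewrite /vertex_mul; case: ifPn => iJ; last first.
  by rewrite face_var_vertex_mul // subrr rpred0.
rewrite linearN opprK /= phi_linear_relationE.
have := weighted_products_Theta (g J i) J; rewrite (bigID (fun a => a <= J)%O) /=.
have iv : i \in vertices J by rewrite in_vertices vi.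
rewrite (bigD1 i) ?vi //= g_dual // eqxx scale1r big1 ?addr0 //.
move=> a /andP[/andP[va aJ] ai].
by rewrite g_dual // ?in_vertices ?va // eq_sym (negPf ai) scale0r.
Qed.

Lemma phi_vertex_op i (x : face_classes k S) : vertex i ->
  v i * phi k x - phi k (vertex_op lam g i x) \in Theta_ideal.
Proof.
move=> vi.
have -> : phi k (vertex_op lam g i x) = \sum_J (x J : k) *: phi k (vertex_mul lam g i J).
  by rewrite vertex_opE linear_sum; apply: eq_bigr => J _; rewrite linearZ.
rewrite {1}/phi mulr_sumr -sumrB.
apply: rpred_sum => J _; rewrite -scalerAr -scalerBr.
exact/rpredZ/phi_vertex_mul.
Qed.

Definition spanned_mod_Theta z :=
  exists x : face_classes k S, z - phi k x \in Theta_ideal.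

Lemma spanned_phi (x : face_classes k S) : spanned_mod_Theta (phi k x).
Proof. by exists x; rewrite subrr rpred0. Qed.

Lemma spanned_linear (a : k) y z :
  spanned_mod_Theta y -> spanned_mod_Theta z -> spanned_mod_Theta (a *: y + z).
Proof.
move=> [y' yy] [z' zz]; exists (a *: y' + z').
rewrite linearP /= opprD addrACA -scalerBr; apply: rpredD => //.
exact: rpredZ.
Qed.

Lemma spanned_sum (T : finType) (P : pred T) (f : T -> face_ring k S) :
  (forall t, P t -> spanned_mod_Theta (f t)) -> spanned_mod_Theta (\sum_(t | P t) f t).
Proof.
move=> fD; apply: big_ind => //.
  by rewrite -(linear0 (phi k : {linear _ -> _})); exact: spanned_phi.
by move=> y z yD zD; rewrite -[y]scale1r; exact: spanned_linear.
Qed.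

Lemma spanned_Theta z t : t \in Theta_ideal -> spanned_mod_Theta z ->
  spanned_mod_Theta (z + t).
Proof. by move=> tT [x zx]; exists x; rewrite addrAC; exact: rpredD. Qed.

Lemma spanned_vertex_mul i z : vertex i ->
  spanned_mod_Theta z -> spanned_mod_Theta (v i * z).
Proof.
move=> vi [x zx]; exists (vertex_op lam g i x).
rewrite -[z](subrK (phi k x)) mulrDr -addrA; apply: rpredD.
  exact: Theta_ideal_mul.
exact: phi_vertex_op.
Qed.

(* Multiplication by a vertex [i] of [N] outside a facet [N'] of [N] turns
   v_N' v_L into v_N v_L: any other join of [i] and [N'] has no join with [L]. *)
Lemma spanned_chain_mul N L : (N <= L)%O -> spanned_mod_Theta (v N * v L).
Proof.
move: {2}#|vertices N| (erefl #|vertices N|) => s.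
elim: s N => [|s IHs] N cN NL.
  have -> : N = \bot%O.
    apply: (vertices_inj S_simplicial (lexx N) (le0x N)).
    by rewrite vertices0; apply/eqP; rewrite -cards_eq0 cN.
  by rewrite face_var_bot mul1r -phi_face_class; exact: spanned_phi.
have [i iN] : exists i, i \in vertices N by apply/card_gt0P; rewrite cN.
have := iN; rewrite in_vertices => /andP[vi leiN].
have [|N' N'N vN'] := @face_of_vertices _ _ S_simplicial N (vertices N :\ i)%SET.
  exact: finset.subsetDl.
have cN' : #|vertices N'| = s.
  by move: (cardsD1 i (vertices N)); rewrite iN cN vN' => /eqP; rewrite eqSS => /eqP.
have iN' : ~~ (i <= N')%O.
  have : i \notin vertices N' by rewrite vN' !inE eqxx.
  by rewrite in_vertices vi.
have vNE P : P \in joins i N' -> vertices P = vertices N.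
  rewrite in_joins // => /and3P[_ _ /eqP ->].
  by rewrite (vertices_vertex vi) vN' finset.setD1K.
have NJ : N \in joins i N'.
  by rewrite in_joins // leiN N'N (vertices_vertex vi) vN' finset.setD1K /=.
have := spanned_vertex_mul vi (IHs N' cN' (le_trans N'N NL)).
rewrite mulrA face_var_vertex_mul // phi_join_sum mulr_suml (bigD1 N) //=.
rewrite big1 ?addr0 // => P /andP[PJ PN]; apply: face_var_mul0.
apply/eqP; apply: contraNT PN => /set0Pn[K]; rewrite in_joins // => /and3P[PK LK _].
by apply/eqP/(vertices_inj S_simplicial PK (le_trans NL LK)); exact: vNE.
Qed.

(** Modulo Theta and by linearity, [z] may be taken to be some v_K. The defining relation turns v_I
    v_K into products v_N v_L with N below L, the case of [spanned_chain_mul]. *)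
Lemma spanned_face_var_mul I z :
  spanned_mod_Theta z -> spanned_mod_Theta (v I * z).
Proof.
move=> [x zx]; rewrite -[z](subrK (phi k x)) mulrDr addrC.
apply: spanned_Theta; first exact: Theta_ideal_mul.
rewrite {1}/phi mulr_sumr; apply: spanned_sum => K _.
rewrite -scalerAr -[_ *: _]addr0; apply: spanned_linear; last first.
  by rewrite -(linear0 (phi k : {linear _ -> _})); exact: spanned_phi.
have [e|/[dup] ne /set0Pn[L]] := eqVneq (joins I K) finset.set0.
  by rewrite face_var_mul0 // -(linear0 (phi k : {linear _ -> _})); exact: spanned_phi.
rewrite in_joins // => /and3P[IL KL _].
have [N meetN] := meet_exists S_simplicial IL KL.
rewrite (face_var_mul ne meetN) mulr_sumr; apply: spanned_sum => L'.
rewrite in_joins // => /and3P[IL' _ _]; apply: spanned_chain_mul.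
by have [NI _ _] := meetN; exact: le_trans IL'.
Qed.

Lemma spanned_all z : spanned_mod_Theta z.
Proof.
have [p <-] := face_ring_projK z.
(* The extra factor [y] lets a monomial be absorbed one variable at a time. *)
suff mulD q y : spanned_mod_Theta y -> spanned_mod_Theta (face_ring_proj q * y).
  rewrite -[face_ring_proj p]mulr1; apply: mulD.
  by rewrite -face_var_bot -phi_face_class; exact: spanned_phi.
elim/mpoly.mpolyind: q y => [|a m q _ _ IH] y yD.
  rewrite (_ : face_ring_proj 0 = 0) ?mul0r; last exact: (raddf0 (\pi_(face_ring k S))).
  by rewrite -(linear0 (phi k : {linear _ -> _})); exact: spanned_phi.
rewrite (_ : face_ring_proj (_ + _) = a *: face_ring_proj (mpoly.mpolyX k m)
    + face_ring_proj q); last first.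
  rewrite -face_ring_projZ; exact: (raddfD (\pi_(face_ring k S))).
rewrite mulrDl -scalerAl; apply: spanned_linear; last exact: IH.
rewrite mpoly.mpolyXE_id.
rewrite [X in X * y](rmorph_prod (\pi_(face_ring k S))).
elim/big_ind: _ y yD => [y yD|x x' xD x'D y yD|t _ y yD]; first by rewrite mul1r.
  by rewrite -mulrA; apply/xD/x'D.
rewrite rmorphXn; elim: (X in _ ^+ X) => [|e IHe]; first by rewrite expr0 mul1r.
rewrite exprS -mulrA; have := spanned_face_var_mul (enum_val t) IHe.
by rewrite /face_var /poly_var enum_valK.
Qed.

End FaceRingQuotient.

(** * Projections and induced isomorphisms of quotients *)

Section Quotients.
Variables (k : comNzRingType).

Lemma module_proj_is_linear (V : lmodType k) (G : set V) : linear (@module_proj k V G).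
Proof.
have scl (a : k) x : x \in submodule_span G -> a *: x \in submodule_span G.
  exact: rpredZ.
move=> a x y; rewrite /module_proj.
rewrite (raddfD (\pi_{ideal_quot (submodule_span G)})); congr (_ + _).
exact: (pi_scale scl).
Qed.

HB.instance Definition _ (V : lmodType k) (G : set V) :=
  GRing.isLinear.Build k V (module_quotient G) _ (@module_proj k V G)
    (module_proj_is_linear G).

Lemma module_proj_eq0 (V : lmodType k) (G : set V) (x : V) :
  module_proj G x = 0 <-> x \in submodule_span G.
Proof.
rewrite -[x in X in _ <-> X]subr0 Quotient.idealrBE.
by rewrite -(raddf0 (\pi_{ideal_quot (submodule_span G)})); split => /eqP.
Qed.

Lemma ideal_proj_is_linear (B : comAlgType k) (G : set B) : linear (@ideal_proj k B G).
Proof.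
have scl (a : k) x : x \in ideal_span G -> a *: x \in ideal_span G.
  exact: rpredZ.
move=> a x y; rewrite /ideal_proj.
rewrite (raddfD (\pi_{ideal_quot (ideal_span G)})); congr (_ + _).
exact: (pi_scale scl).
Qed.

HB.instance Definition _ (B : comAlgType k) (G : set B) :=
  GRing.isLinear.Build k B (ideal_quotient G) _ (@ideal_proj k B G)
    (ideal_proj_is_linear G).

Lemma ideal_proj_eq0 (B : comAlgType k) (G : set B) (x : B) :
  ideal_proj G x = 0 <-> x \in ideal_span G.
Proof.
rewrite -[x in X in _ <-> X]subr0 Quotient.idealrBE.
by rewrite -(raddf0 (\pi_{ideal_quot (ideal_span G)})); split => /eqP.
Qed.

Lemma module_quotient_iso (V : lmodType k) (B : comAlgType k) (G : set V)
    (H : set B) (f : {linear V -> B}) :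
  (forall x, f x \in ideal_span H <-> x \in submodule_span G) ->
  (forall z, exists x, z - f x \in ideal_span H) ->
  exists ft : {linear module_quotient G -> ideal_quotient H},
    (forall x, ft (module_proj G x) = ideal_proj H (f x)) /\ bijective ft.
Proof.
move=> f_ker f_surj.
pose ft (y : module_quotient G) : ideal_quotient H :=
  ideal_proj H (f (repr (y : {ideal_quot (submodule_span G)}))).
have reprP (y : module_quotient G) :
    module_proj G (repr (y : {ideal_quot (submodule_span G)})) = y.
  exact: reprK.
have ftE x : ft (module_proj G x) = ideal_proj H (f x).
  apply/eqP; rewrite -subr_eq0 -linearB -linearB; apply/eqP/ideal_proj_eq0.
  by apply/f_ker/module_proj_eq0; rewrite linearB /= reprP subrr.
have ft_linear : linear ft.
  move=> a x y; rewrite -[x]reprP -[y]reprP -linearP !ftE.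
  by rewrite !linearP.
pose ftL := GRing.isLinear.Build k (module_quotient G) (ideal_quotient H) _ ft ft_linear.
pose ft' : {linear module_quotient G -> ideal_quotient H} := HB.pack ft ftL.
exists ft'; split; first exact: ftE.
have ft_surj (z : ideal_quotient H) : exists y, ft y = z.
  have zE : ideal_proj H (repr (z : {ideal_quot (ideal_span H)})) = z by exact: reprK.
  have [x /ideal_proj_eq0] := f_surj (repr (z : {ideal_quot (ideal_span H)})).
  rewrite linearB /= zE => /eqP; rewrite subr_eq0 => /eqP zx.
  by exists (module_proj G x); rewrite ftE.
have ft_inj : injective ft.
  move=> x y; rewrite -[x]reprP -[y]reprP !ftE => /eqP.
  rewrite -subr_eq0 -linearB -linearB => /eqP /ideal_proj_eq0 /f_ker.
  by move/module_proj_eq0; rewrite linearB /= => /eqP; rewrite subr_eq0 => /eqP.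
have [h hK] := choice ft_surj.
by exists h => // x; apply: ft_inj; rewrite hK.
Qed.

End Quotients.

(** * Assembly of the isomorphism *)

Theorem proposition4p3 (k : comNzRingType) (R : realType) (n : nat)
    (Q : topologicalType) (atlas : set (chart R n Q))
    (Q_manifold : manifold_with_corners atlas)
    (Q_compact : compact [set: Q]) (Q_connected : connected [set: Q])
    (Q_orientable : orientable atlas)
    (Q_nice : faces_in_expected_facets atlas)
    (Q_acyclic : acyclic_proper_faces k atlas)
    (d : Order.disp_t) (S : finBPOrderType d) (F : S -> set Q)
    (S_faces : is_face_poset atlas F) (S_simplicial : simplicial_poset S)
    (T : S -> set 'rV[complexes R]_n) (T_char : characteristic_function F T)
    (lam : S -> 'I_n -> int)
    (lam_generator : forall i : S, vertex i -> toric_generator (T i) (lam i))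
    (o : S -> seq S -> bool) (o_orientation : is_orientation o) :
  exists phit : {linear module_quotient (relations k lam o) ->
                        ideal_quotient (Theta k lam)},
    (forall x : face_classes k S,
       phit (module_proj (relations k lam o) x)
         = ideal_proj (Theta k lam) (phi k x)) /\
    bijective phit.
Proof.
have /choice[g g_dual] : forall K : S, exists g : S -> 'I_n -> k, forall i j,
    i \in vertices K -> j \in vertices K -> weight lam (g i) j = (i == j)%:R.
  move=> K; apply: (dual_vectors k lam_generator).
  have vK i : i \in vertices K -> vertex i by rewrite in_vertices => /andP[].
  exact: (T_char.2 _ vK (faces_of_simplex_meet K S_faces)).1.
pose W := relations k lam o.
pose pr : {linear face_classes k S -> module_quotient W} := module_proj W.
pose sec (y : module_quotient W) : face_classes k S :=
  repr (y : {ideal_quot (submodule_span W)}).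
have secK : cancel sec pr by move=> y; exact: reprK.
have relE m J : orthogonal_to lam J m -> linear_relation lam m J \in submodule_span W.
  exact: (linear_relation_span S_simplicial o_orientation (g_dual J)).
have pr_rel m J : orthogonal_to lam J m -> pr (linear_relation lam m J) = 0.
  by move=> mJ; apply/module_proj_eq0/relE.
(* Together with [relE], this says that the R_{J,A} and the linear relations span the same
   submodule, the inclusion here being tested by linear maps. *)
have pr_univ (U : lmodType k) (f : {linear face_classes k S -> U}) :
    (forall m J, orthogonal_to lam J m -> f (linear_relation lam m J) = 0) ->
    forall x, x \in submodule_span W -> f x = 0.
  move=> f0 x /asboolP[s [sW ->]]; rewrite linear_sum big_seq big1 // => p /sW.
  move=> [J [A [cJA ->]]]; rewrite linearZ /=.
  have [m [mJ ->]] := relation_R_linear k lam S_simplicial o_orientation cJA.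
  by rewrite f0 // scaler0.
have pr_univ' (f : {linear face_classes k S -> module_quotient W}) :
    (forall m J, orthogonal_to lam J m -> f (linear_relation lam m J) = 0) ->
    forall x, pr x = 0 -> f x = 0.
  by move=> f0 x /module_proj_eq0; exact: pr_univ.
apply: module_quotient_iso => [x|z]; last exact: (spanned_all S_simplicial g_dual).
split=> [xT|]; last first.
  move/(pr_univ _ (ideal_proj (Theta k lam) \o phi k)) => xW.
  apply/ideal_proj_eq0/xW => m J mJ /=.
  by apply/ideal_proj_eq0; exact: phi_linear_relation.
apply/module_proj_eq0.
pose X := quotient_op lam g pr sec.
have X_linear i : vertex i -> linear (X i).
  exact: (quotient_op_is_linear S_simplicial g_dual pr_rel pr_univ' secK).
have X_comm i j y : vertex i -> vertex j -> X i (X j y) = X j (X i y).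
  exact: (quotient_opC S_simplicial g_dual pr_rel pr_univ' secK).
have X_class i K : vertex i -> ~~ (i <= K)%O ->
    X i (pr (face_class k K)) = \sum_(L in joins i K) pr (face_class k L).
  move=> vi iK; rewrite /X (quotient_op_pr S_simplicial g_dual pr_rel pr_univ' secK) //.
  by rewrite vertex_op_class vertex_mul_notin // linear_sum.
have X_theta j y : \sum_(a | vertex a) (lam a j)%:~R *: X a y = 0.
  (* The weight of the [j]-th standard basis vector is the coefficient occurring in theta_j. *)
  rewrite -[RHS](quotient_op_theta S_simplicial g_dual pr_rel pr_univ' secK
    (fun l => (l == j)%:R) y).
  apply: eq_bigr => a _; congr (_ *: _); rewrite /weight (bigD1 j) //= eqxx mul1r.
  by rewrite big1 ?addr0 // => l /negPf ->; rewrite mul0r.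
(* The map from the face ring kills [phi k x], which lies in the ideal of Theta, and also sends it
   to the class of [x]; so this class is zero. *)
have := face_ring_value_Theta S_simplicial X_linear X_comm X_class X_theta xT.
rewrite face_ring_value_phi // => <-.
rewrite {1}[x]face_classes_sum linear_sum; apply: eq_bigr => I _.
by rewrite linearZ.
Qed.
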